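(* For every antithetical instance of the shared processor scheduling problem, there exists an optimal schedule that is synchronized, processing-time ordered, and in which every job is present on the shared processors. Moreover, such a schedule can be computed in polynomial time.
   Context: An instance consists of a set $\mathcal{J}$ of $n$ jobs, each job $j$ having a processing time $p_j\ge 0$ and a weight $w_j\ge 0$, and $m\ge 1$ shared processors $\mathcal{M}_1,\dots,\mathcal{M}_m$ with costs $c_1\le\cdots\le c_m$; each job $j$ has a private processor $\mathcal{P}_j$ usable only by $j$. A schedule selects for each job $j$ a finite collection of pairwise disjoint open intervals (pieces) on each shared processor and a single interval $(0,C_j)$ on $\mathcal{P}_j$. It is feasible if for each $j$, $C_j$ plus the total length of pieces of $j$ equals $p_j$; pieces of different jobs on the same shared processor are disjoint (pieces of the same job on different shared processors may overlap); and every piece of $j$ is contained in $(0,C_j)$. The total weighted overlap is $\sum_{i=1}^m\sum_j o(j,\mathcal{M}_i)(w_j-c_i)$, where $o(j,\mathcal{M}_i)$ is the total length of time during which $j$ executes simultaneously on $\mathcal{P}_j$ and $\mathcal{M}_i$; an optimal schedule is a feasible one maximizing it. An instance is antithetical if for any two jobs $j,j'$, $p_j\le p_{j'}$ implies $w_j\ge w_{j'}$. A feasible schedule is synchronized if there is a subset $\{j_1,\dots,j_k\}\subseteq\mathcal{J}$ such that every job not in it executes only on its private processor in $(0,p_j)$, and there exist integers $m\ge m_1\ge\cdots\ge m_k\ge1$ and times $0=t_0\le t_1\le\cdots\le t_k$ such that for each $i$, job $j_i$ executes exactly in $(t_{i-1},t_i)$ on each of $\mathcal{M}_1,\dots,\mathcal{M}_{m_i}$,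 on no other shared processor, and in $(0,t_i)$ on $\mathcal{P}_{j_i}$. The jobs $j_1,\dots,j_k$ (in this order) are the jobs present on the shared processors; a synchronized schedule is processing-time ordered if $p_{j_1}\le\cdots\le p_{j_k}$. Every job being present on the shared processors means $\{j_1,\dots,j_k\}=\mathcal{J}$.
   Formalization: Presence on the shared processors is required only of jobs with w_j ≥ c_1 (all jobs, if every w_j ≥ c_1); as stated the claim fails, e.g. for one job with p=1, w=0 and one processor of cost 1, where the only optimum leaves the processor idle. *)

(* Defs.v *)
(* MathComp world. *)
From HB Require Import structures.
From mathcomp Require Import all_boot all_order all_algebra.

Set Implicit Arguments.
Unset Strict Implicit.
Unset Printing Implicit Defensive.

Import Order.TTheory GRing.Theory Num.Theory.
Local Open Scope ring_scope.

(** * Shared processor scheduling *)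

Record instance (R : Type) := Instance {
  njobs : nat;
  nprocs : nat;
  ptime : 'I_njobs -> R;
  weight : 'I_njobs -> R;
  cost : 'I_nprocs -> R
}.

Arguments ptime {R} I j : rename.
Arguments weight {R} I j : rename.
Arguments cost {R} I l : rename.

Definition valid (R : realFieldType) (I : instance R) : Prop :=
  [/\ (0 < nprocs I)%N,
      forall j, 0 <= ptime I j,
      forall j, 0 <= weight I j &
      forall l l' : 'I_(nprocs I), (l <= l')%N -> cost I l <= cost I l'].

Definition antithetical (R : realFieldType) (I : instance R) : Prop :=
  forall j j' : 'I_(njobs I),
    ptime I j <= ptime I j' -> weight I j' <= weight I j.

(* [completion S j] is the C_j such that j runs in (0, C_j) on its private
   processor; [pieces S j l] lists the open intervals (a, b), given by their
   endpoints, in which j runs on the shared processor l. *)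
Record schedule (R : Type) (n m : nat) := Schedule {
  completion : 'I_n -> R;
  pieces : 'I_n -> 'I_m -> seq (R * R)
}.

Definition schedule_for (R : Type) (I : instance R) : Type :=
  schedule R (njobs I) (nprocs I).

Section Scheduling.
Variable R : realFieldType.

(* For nonempty open intervals, i.e. a < b. *)
Definition itv_disjoint (x y : R * R) : bool := (x.2 <= y.1) || (y.2 <= x.1).

Record feasible (I : instance R) (S : schedule_for I) : Prop := Feasible {
  feasible_completion : forall j, 0 <= completion S j;
  feasible_nonempty : forall j l x, x \in pieces S j l -> x.1 < x.2;
  feasible_self : forall j l, pairwise itv_disjoint (pieces S j l);
  feasible_total : forall j,
    completion S j + \sum_l \sum_(x <- pieces S j l) (x.2 - x.1) = ptime I j;
  feasible_others : forall j j' l x y, j != j' ->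
    x \in pieces S j l -> y \in pieces S j' l -> itv_disjoint x y;
  feasible_inside : forall j l x, x \in pieces S j l ->
    0 <= x.1 /\ x.2 <= completion S j
}.

(* The measure of (0, C_j) intersected with the union of the disjoint pieces. *)
Definition overlap (n m : nat) (S : schedule R n m) (j : 'I_n) (l : 'I_m) : R :=
  \sum_(x <- pieces S j l)
    Num.max 0 (Num.min x.2 (completion S j) - Num.max x.1 0).

Definition total_weighted_overlap (I : instance R) (S : schedule_for I) : R :=
  \sum_l \sum_j overlap S j l * (weight I j - cost I l).

Definition optimal (I : instance R) (S : schedule_for I) : Prop :=
  feasible S /\
  forall S' : schedule_for I, feasible S' ->
    total_weighted_overlap S' <= total_weighted_overlap S.

Definition executes (n m : nat) (S : schedule R n m) (j : 'I_n) (l : 'I_m)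
    (x : R) : bool :=
  has (fun y : R * R => y.1 < x < y.2) (pieces S j l).

(* Everything is 0-based: [js i] and [mu i] stand for j_(i+1) and m_(i+1),
   which is run in (t_i, t_(i+1)) on the processors l < m_(i+1); only the
   values t_0, ..., t_k of [t] matter. *)
Record synchronized (I : instance R) (S : schedule_for I) (k : nat)
    (js : 'I_k -> 'I_(njobs I)) (mu : 'I_k -> nat) (t : nat -> R) : Prop :=
  Synchronized {
  synchronized_feasible : feasible S;
  synchronized_inj : injective js;
  synchronized_t0 : t 0%N = 0;
  synchronized_t : forall i : 'I_k, t i <= t i.+1;
  synchronized_mu : forall i, (1 <= mu i <= nprocs I)%N;
  synchronized_mu_anti : forall i i' : 'I_k, (i <= i')%N -> (mu i' <= mu i)%N;
  synchronized_absent : forall j, (forall i, js i <> j) ->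
    completion S j = ptime I j /\ forall l, pieces S j l = [::];
  synchronized_shared : forall (i : 'I_k) (l : 'I_(nprocs I)) (x : R),
    executes S (js i) l x = (l < mu i)%N && (t i < x < t i.+1);
  synchronized_private : forall i : 'I_k, completion S (js i) = t i.+1
}.

Definition processing_time_ordered (I : instance R) (k : nat)
    (js : 'I_k -> 'I_(njobs I)) : Prop :=
  forall i i' : 'I_k, (i <= i')%N -> ptime I (js i) <= ptime I (js i').

(* Only jobs whose weight is at least the cost of some (equivalently, of the
   cheapest) shared processor are required to be present: a present job with
   p_j > 0 and t_(i-1) < p_j has positive overlap, which can only decrease the
   objective if w_j < c_1.  E.g. with n = m = 1, p = 1, w = 0 and c = 1, the
   only optimal schedule leaves the shared processor idle.  If w_j >= c_1 for
   all j, this says {j_1, ..., j_k} is the set of all jobs. *)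
Definition all_present (I : instance R) (k : nat)
    (js : 'I_k -> 'I_(njobs I)) : Prop :=
  forall j, (exists l, cost I l <= weight I j) -> exists i, js i = j.

Definition optimal_synchronized (I : instance R) (S : schedule_for I) : Prop :=
  optimal S /\
  exists (k : nat) (js : 'I_k -> 'I_(njobs I)) (mu : 'I_k -> nat)
         (t : nat -> R),
    [/\ synchronized S js mu t, processing_time_ordered js & all_present js].

End Scheduling.

Definition map_instance (R R' : Type) (f : R -> R') (I : instance R) :
    instance R' :=
  @Instance R' (njobs I) (nprocs I)
    (f \o ptime I) (f \o weight I) (f \o cost I).

Definition map_schedule (R R' : Type) (f : R -> R') (n m : nat)
    (S : schedule R n m) : schedule R' n m :=
  Schedule (f \o completion S)
    (fun j l => [seq (f x.1, f x.2) | x <- pieces S j l]).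

(** * Polynomial time

    Random access machines with logarithmic cost, programmed with structured
    control flow.  Cells hold rationals, and an instruction is charged the bit
    length of all its operands (indirect addresses included) and of its result.
    As +, -, *, / and <= on rationals in lowest terms take time polynomial in
    the bit length, polynomial cost is polynomial time on Turing machines. *)

Definition natbits (n : nat) : nat := (trunc_log 2 n).+1.

Definition ratbits (q : rat) : nat :=
  (1 + natbits `|numq q|%N + natbits `|denq q|%N)%N.

Definition input_size (s : seq rat) : nat := (\sum_(q <- s) ratbits q)%N.

Inductive arith := Plus | Minus | Times | Divide.

Definition eval_arith (o : arith) (x y : rat) : rat :=
  match o with
  | Plus => x + y
  | Minus => x - y
  | Times => x * y
  | Divide => x / y
  end.

(* Arguments of type nat are names of scalar registers. *)
Inductive cmd :=
  | Skip
  | Const (d : nat) (q : rat)                     (* d := q *)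
  | Arith (o : arith) (d a b : nat)               (* d := a o b *)
  | Fetch (d a : nat)                             (* d := memory[a] *)
  | Store (a b : nat)                             (* memory[a] := b *)
  | Write (a : nat)                               (* append a to the output *)
  | Seq (c1 c2 : cmd)
  | IfLe (a b : nat) (c1 c2 : cmd)                (* if a <= b *)
  | WhileLe (a b : nat) (c : cmd).                (* while a <= b *)

Record state := State {
  registers : nat -> rat;
  memory : nat -> rat;
  out : seq rat
}.

Definition update (f : nat -> rat) (i : nat) (q : rat) : nat -> rat :=
  fun i' => if i' == i then q else f i'.

(* [exec c s s' T]: started in s, c halts in s' with total cost T.  Fetches and
   stores are stuck unless the address is a natural number. *)
Inductive exec : cmd -> state -> state -> nat -> Prop :=
  | ExecSkip s : exec Skip s s 1
  | ExecConst d q s :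
      exec (Const d q) s (State (update (registers s) d q) (memory s) (out s))
        (ratbits q)
  | ExecArith o d a b s x y z :
      registers s a = x -> registers s b = y -> eval_arith o x y = z ->
      exec (Arith o d a b) s
        (State (update (registers s) d z) (memory s) (out s))
        (ratbits x + ratbits y + ratbits z)%N
  | ExecFetch d a s (i : nat) x :
      registers s a = i%:R -> memory s i = x ->
      exec (Fetch d a) s (State (update (registers s) d x) (memory s) (out s))
        (natbits i + ratbits x)%N
  | ExecStore a b s (i : nat) x :
      registers s a = i%:R -> registers s b = x ->
      exec (Store a b) s (State (registers s) (update (memory s) i x) (out s))
        (natbits i + ratbits x)%N
  | ExecWrite a s x :
      registers s a = x ->
      exec (Write a) s (State (registers s) (memory s) (rcons (out s) x))
        (ratbits x)
  | ExecSeq c1 c2 s1 s2 s3 T1 T2 :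
      exec c1 s1 s2 T1 -> exec c2 s2 s3 T2 ->
      exec (Seq c1 c2) s1 s3 (T1 + T2)%N
  | ExecIfLe a b c1 c2 s s' x y T :
      registers s a = x -> registers s b = y ->
      exec (if x <= y then c1 else c2) s s' T ->
      exec (IfLe a b c1 c2) s s' (ratbits x + ratbits y + T)%N
  | ExecWhileStop a b c s x y :
      registers s a = x -> registers s b = y -> ~~ (x <= y) ->
      exec (WhileLe a b c) s s (ratbits x + ratbits y)%N
  | ExecWhileStep a b c s s1 s2 x y T1 T2 :
      registers s a = x -> registers s b = y -> x <= y ->
      exec c s s1 T1 -> exec (WhileLe a b c) s1 s2 T2 ->
      exec (WhileLe a b c) s s2 (ratbits x + ratbits y + T1 + T2)%N.

Definition initial (input : seq rat) : state :=
  State (fun=> 0) (nth 0 input) [::].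

Definition runs_in (c : cmd) (input output : seq rat) (T : nat) : Prop :=
  exists s' T',
    [/\ exec c (initial input) s' T', out s' = output & (T' <= T)%N].

(* One program computes, for every x in the domain, the encoding of some
   solution for x, within a polynomial of the bit length of the input. *)
Definition polytime_computable (X : Type) (Y : X -> Type)
    (encode_input : X -> seq rat) (encode_output : forall x, Y x -> seq rat)
    (dom : X -> Prop) (solution : forall x, Y x -> Prop) : Prop :=
  exists (c : cmd) (P : {poly nat}), forall x, dom x ->
    exists2 y : Y x, solution x y &
      runs_in c (encode_input x) (encode_output x y)
        P.[input_size (encode_input x)].

Definition encode_instance (I : instance rat) : seq rat :=
  [:: (njobs I)%:R; (nprocs I)%:R]
    ++ [seq ptime I j | j <- enum 'I_(njobs I)]
    ++ [seq weight I j | j <- enum 'I_(njobs I)]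
    ++ [seq cost I l | l <- enum 'I_(nprocs I)].

Definition encode_pieces (s : seq (rat * rat)) : seq rat :=
  (size s)%:R :: flatten [seq [:: x.1; x.2] | x <- s].

Definition encode_schedule (n m : nat) (S : schedule rat n m) : seq rat :=
  flatten [seq completion S j ::
                 flatten [seq encode_pieces (pieces S j l) | l <- enum 'I_m]
          | j <- enum 'I_n].

(* Main.v *)
Require Import Defs.
From HB Require Import structures.
From mathcomp Require Import all_boot all_order all_algebra.
From mathcomp Require Import fingroup perm.
From mathcomp Require Import zify ring lra.

Set Implicit Arguments.
Unset Strict Implicit.
Unset Printing Implicit Defensive.

Import Order.TTheory GRing.Theory Num.Theory.
Local Open Scope ring_scope.

(** Number the jobs 0, ..., n - 1 by increasing processing time, hence decreasing
    weight.  In a synchronized schedule with [m_i] processors for job i,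
    [t_(i+1) (m_i + 1) = p_i + m_i t_i], and the value of jobs i, ..., n - 1
    started at time t is [A_i - B_i t]; the best [m_i] does not depend on t.
    Put [u_i = w_i - (B_i - B_(i+1))].  Optimizing backwards amounts to
    [B_i = sum_l max 0 (u_i - c_l)] with [m_i] the number of l such that
    [c_l <= u_i], and the value of the schedule is [sum_i (B_i - B_(i+1)) p_i].
    In an antithetical instance [u] is nonincreasing and [B_i >= B_(i+1)], so the
    [m_i] are nonincreasing.  Conversely, for a feasible schedule let
    [D_0 <= ... <= D_(n-1)] be the sorted completion times: the objective is
    [sum_j w_j (p_j - C_j)] minus the cost of the usage of the processors, it can
    only increase if [C_j] is replaced with [D_i] for the job j in position i, and
    two summations by parts together with the capacity of the processors between
    consecutive [D_i] bound it by [sum_i (B_i - B_(i+1)) p_i]. *)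

(** The recurrence for [B] comes from a single job. With k processors, the job in position i started
    at t <= p_i ends at [t + (p_i - t) / (k + 1)], so B_i is the largest value over k of [(sum_(l <
    k) (w_i + B_(i+1) - c_l)) / (k + 1)]. Multiplying by k + 1 turns this into the implicit equation
    [B_i = sum_l max 0 (w_i + B_(i+1) - B_i - c_l)], whose inner quantity is u_i. The relations
    between [u], [B], the counts and the times act as a certificate: they alone bound every feasible
    schedule. An embedding of the rationals into a real field preserves them, so the computed
    rational schedule stays optimal among schedules over any larger field. For polynomial time the
    danger is the size of the numbers: the recurrences for profits and times use the previous value
    only once, so that bits are added, not multiplied, at each round. *)

Section Rank.
Variables (R : realFieldType) (n : nat) (a : nat -> R).

(* Strict order by [a] with ties broken by index, phrased with the two tests
   [a _ <= a _] and [_ <= _] that the program branches on. *)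
Definition before (j' j : nat) : bool :=
  if (j <= j')%N then ~~ (a j <= a j') else a j' <= a j.

Lemma before_irr j : before j j = false.
Proof. by rewrite /before leqnn lexx. Qed.

Lemma before_trans : transitive before.
Proof.
move=> y x z; rewrite /before -!ltNge.
by case: ifP => h1; case: ifP => h2; case: ifP => h3 xy yz; lra || (exfalso; lia).
Qed.

Lemma before_total j j' : j != j' -> before j j' || before j' j.
Proof.
rewrite /before -!ltNge.
case: (ltngtP j j') => //= _ _; first by case: leP.
by case: ltP.
Qed.

(** Counting predecessors gives the final position of each job by one scan, without exchanging
    entries; quadratic time is enough here. *)
Definition rank (j : nat) : nat := (\sum_(j' < n) before j' j)%N.

Lemma rank_before j j' : (j < n)%N -> before j j' -> (rank j < rank j')%N.
Proof.
move=> jn jj'; rewrite /rank (bigD1 (Ordinal jn)) //= [ltnRHS](bigD1 (Ordinal jn)) //=.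
rewrite before_irr jj' add0n add1n ltnS; apply: leq_sum => i _.
by case: (boolP (before i j)) => // ij; rewrite (before_trans ij jj').
Qed.

Lemma rank_lt j : (j < n)%N -> (rank j < n)%N.
Proof.
move=> jn; rewrite /rank (bigD1 (Ordinal jn)) //= before_irr add0n.
apply: (@leq_trans (\sum_(i < n | i != Ordinal jn) 1).+1).
  by rewrite ltnS; apply: leq_sum => i _; case: before.
by rewrite sum1_card cardC1 card_ord prednK // (leq_ltn_trans _ jn).
Qed.

Lemma rank_inj j j' : (j < n)%N -> (j' < n)%N -> rank j = rank j' -> j = j'.
Proof.
move=> jn jn' e; apply/eqP; apply: contraT => /before_total.
by case/orP => /rank_before; rewrite ?jn ?jn' e ltnn => /(_ isT).
Qed.

Lemma rank_sorted j j' : (j' < n)%N -> (rank j <= rank j')%N -> a j <= a j'.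
Proof.
move=> jn; apply: contraTT; rewrite -ltNge -ltnNge => h.
by apply: rank_before => //; rewrite /before -ltNge h (ltW h) if_same.
Qed.

Definition rank_ord (j : 'I_n) : 'I_n := Ordinal (rank_lt (ltn_ord j)).

Lemma rank_ord_inj : injective rank_ord.
Proof. by move=> j j' /(congr1 val)/= /rank_inj e; apply: val_inj; apply: e. Qed.

Definition rank_perm : {perm 'I_n} := perm rank_ord_inj.

Lemma rank_permE (j : 'I_n) : rank_perm j = rank j :> nat.
Proof. by rewrite permE. Qed.

End Rank.

(** Indexing by natural numbers, with 0 out of range, lets the recurrences and memory addresses
    compute with positions freely. *)
Definition table (R : nmodType) (n : nat) (a : 'I_n -> R) (i : nat) : R :=
  nth 0 [seq a j | j <- enum 'I_n] i.

Lemma tableE (R : nmodType) (n : nat) (a : 'I_n -> R) (j : 'I_n) :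
  table a j = a j.
Proof. by rewrite /table (nth_map j) ?size_enum_ord // nth_ord_enum. Qed.

Lemma exists_sorting_perm (R : realFieldType) (n : nat) (a : 'I_n -> R) :
  exists rho : {perm 'I_n},
    forall j j', (rho j <= rho j')%N -> a j <= a j'.
Proof.
exists (rank_perm n (table a)) => j j'; rewrite !rank_permE => h.
by rewrite -!(tableE a); apply: rank_sorted h.
Qed.

(** * Summation by parts and rearrangement *)

(** Peel off the last index: its [v] is the least, so it can replace [b] in the shorter sum, and
    lowering it to [b] afterwards is harmless because the total of [d] is nonnegative. *)
Lemma abel_sum_ge (R : realFieldType) (n : nat) (v d : 'I_n -> R) (b : R) :
  (forall i i' : 'I_n, (i <= i')%N -> v i' <= v i) -> (forall i, b <= v i) ->
  (forall r, (r <= n)%N -> 0 <= \sum_(i < n | (i < r)%N) d i) ->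
  b * \sum_i d i <= \sum_i v i * d i.
Proof.
elim: n => [|n IHn] in v d b *; first by rewrite !big_ord0 mulr0.
move=> v_anti bv d_ge0.
have dT r (f : 'I_n.+1 -> R) : (r <= n)%N ->
    \sum_(i < n.+1 | (i < r)%N) f i = \sum_(i < n | (i < r)%N) f (widen_ord (leqnSn n) i).
  move=> rn; rewrite (big_mkcond (fun i : 'I_n.+1 => (i < r)%N)) big_ord_recr /=.
  by rewrite ltnNge rn /= addr0 -big_mkcond.
have /= IH := IHn (v \o widen_ord (leqnSn n)) (d \o widen_ord (leqnSn n)) (v ord_max).
apply: (@le_trans _ _ (v ord_max * \sum_i d i)).
  apply: ler_wpM2r (bv _).
  have -> : \sum_i d i = \sum_(i < n.+1 | (i < n.+1)%N) d i.
    by apply: eq_bigl => i; rewrite ltn_ord.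
  exact: d_ge0.
rewrite !big_ord_recr /= mulrDr lerD2r; apply: IH => [i i' ii'|i|r rn].
- exact: v_anti.
- by apply: v_anti; rewrite leq_ord.
- by rewrite -(dT r d rn); apply: d_ge0; apply: leqW.
Qed.

(** Equal totals make the boundary term of the summation by parts vanish, so [v] may take either
    sign, as [u] does. *)
Lemma abel_ler_sum (R : realFieldType) (n : nat) (v x y : 'I_n -> R) :
  (forall i i' : 'I_n, (i <= i')%N -> v i' <= v i) ->
  (forall r, (r <= n)%N ->
     \sum_(i < n | (i < r)%N) x i <= \sum_(i < n | (i < r)%N) y i) ->
  \sum_i x i = \sum_i y i -> \sum_i v i * x i <= \sum_i v i * y i.
Proof.
case: n => [|n] in v x y *; first by rewrite !big_ord0.
move=> v_anti xy exy; rewrite -subr_ge0 -sumrB.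
under eq_bigr do rewrite -mulrBr.
apply: le_trans (abel_sum_ge (b := v ord_max) v_anti _ _).
- by rewrite sumrB exy subrr mulr0.
- by move=> i; apply: v_anti; rewrite leq_ord.
- by move=> r rn; rewrite sumrB subr_ge0 xy.
Qed.

(** Subtract the threshold [v], the value at sorted position [r]. The sorted prefix then collects
    every negative part, so its sum is the total of [Num.min 0 (a j - v)], and no other choice of
    [r] indices goes below that. *)
Lemma sum_sorted_prefix_le (R : realFieldType) (n : nat) (a : 'I_n -> R)
    (sigma tau : {perm 'I_n}) (r : nat) :
  (forall i i' : 'I_n, (i <= i')%N -> a (sigma i) <= a (sigma i')) ->
  \sum_(i < n | (i < r)%N) a (sigma i) <= \sum_(i < n | (i < r)%N) a (tau i).
Proof.
move=> a_mono; have [nr|rn] := leqP n r.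
  have e (f : 'I_n -> R) : \sum_(i < n | (i < r)%N) f i = \sum_i f i.
    by apply: eq_bigl => i; rewrite (leq_trans (ltn_ord i)).
  rewrite !e -(reindex_inj (@perm_inj _ sigma) (F := a) (P := xpredT)).
  by rewrite -(reindex_inj (@perm_inj _ tau) (F := a) (P := xpredT)).
set v := a (sigma (Ordinal rn)).
rewrite -subr_ge0 -sumrB.
have {1}-> : \sum_(i < n | (i < r)%N) (a (tau i) - a (sigma i)) =
    \sum_(i < n | (i < r)%N) (a (tau i) - v) - \sum_(i < n | (i < r)%N) (a (sigma i) - v).
  by rewrite -sumrB; apply: eq_bigr => i _; ring.
have -> : \sum_(i < n | (i < r)%N) (a (sigma i) - v) = \sum_i Num.min 0 (a (sigma i) - v).
  rewrite big_mkcond; apply: eq_bigr => i _; case: ltnP => ir.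
    by rewrite min_r // subr_le0; apply: a_mono; apply: ltnW.
  by rewrite min_l // subr_ge0; apply: a_mono.
rewrite -(reindex_inj (@perm_inj _ sigma) (F := fun j => Num.min 0 (a j - v)) (P := xpredT)) /=.
rewrite (reindex_inj (@perm_inj _ tau) (F := fun j => Num.min 0 (a j - v)) (P := xpredT)) /=.
rewrite big_mkcond /= -sumrB.
apply: sumr_ge0 => i _; case: ifP => _; rewrite minEle; case: ifP => ?; lra.
Qed.

(** * Lengths of intervals within a time window *)

Definition clip (R : realFieldType) (a b : R) (x : R * R) : R :=
  Num.max 0 (Num.min x.2 b - Num.max x.1 a).

Lemma clip_ge0 (R : realFieldType) (a b : R) (x : R * R) : 0 <= clip a b x.
Proof. by rewrite le_max lexx. Qed.

Lemma clip_id (R : realFieldType) (a b : R) (x : R * R) :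
  a <= x.1 -> x.1 < x.2 -> x.2 <= b -> clip a b x = x.2 - x.1.
Proof.
by move=> ax xx xb; rewrite /clip (min_l xb) (max_l ax) max_r // subr_ge0 ltW.
Qed.

Lemma clip_cat (R : realFieldType) (a b c : R) (x : R * R) :
  a <= b -> b <= c -> x.1 < x.2 -> clip a c x = clip a b x + clip b c x.
Proof.
move=> ab bc xx; rewrite /clip; have [xb|bx] := leP x.2 b.
  rewrite (min_l (le_trans xb bc)) [Num.max 0 (_ - Num.max _ b)]max_l ?addr0 //.
  by rewrite subr_le0 (le_trans xb) // le_max lexx orbT.
have [xb|bx'] := leP x.1 b.
  rewrite ![Num.max 0 _]max_r; first (by lra); rewrite subr_ge0.
  - by rewrite le_min bc ltW.
  - by rewrite ge_max xb.
  - rewrite ge_max !le_min (ltW xx) (le_trans xb bc) (le_trans ab bc).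
    by rewrite (le_trans ab (ltW bx)).
rewrite (max_l (le_trans ab (ltW bx'))) [Num.max 0 (b - x.1)]max_l ?add0r //.
by rewrite subr_le0 ltW.
Qed.

(** Induction on the list for all windows at once: the first interval cuts the window into a left
    and a right part, and the other intervals have nothing in between. *)
Lemma sum_clip_le (R : realFieldType) (s : seq (R * R)) (a b : R) :
  a <= b -> (forall x, x \in s -> x.1 < x.2) -> pairwise (@itv_disjoint R) s ->
  \sum_(x <- s) clip a b x <= b - a.
Proof.
elim: s => [|x s IHs] in a b *; first by rewrite big_nil subr_ge0.
move=> ab s_lt; rewrite big_cons /= => /andP[/allP xs s_dis].
have {}IHs a' b' : a' <= b' -> \sum_(y <- s) clip a' b' y <= b' - a'.
  by move=> ab'; apply: IHs => // y ys; apply: s_lt; rewrite inE ys orbT.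
have x_lt : x.1 < x.2 by apply: s_lt; rewrite mem_head.
have [out|] := leP (Num.min x.2 b) (Num.max x.1 a).
  by rewrite /clip max_l ?subr_le0 // add0r; apply: IHs.
set hi := Num.min _ _; set lo := Num.max _ _ => lo_hi.
have ? : a <= lo by rewrite le_max lexx orbT.
have ? : hi <= b by rewrite ge_min lexx orbT.
have -> : \sum_(y <- s) clip a b y =
    \sum_(y <- s) clip a lo y + \sum_(y <- s) clip hi b y.
  rewrite -big_split /=; apply: eq_big_seq => y ys.
  have y_lt : y.1 < y.2 by apply: s_lt; rewrite inE ys orbT.
  have /orP xy := xs y ys.
  rewrite (@clip_cat _ a lo b) //; last by lra.
  congr (_ + _); rewrite (@clip_cat _ lo hi b) //; last exact: ltW.
  suff -> : clip lo hi y = 0 by rewrite add0r.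
  apply: max_l; rewrite subr_le0; case: xy => yx.
    have hy : hi <= y.1 by apply: le_trans yx; rewrite ge_min lexx.
    by rewrite ge_min !le_max hy orbT.
  have ly : y.2 <= lo by apply: le_trans yx _; rewrite le_max lexx.
  by rewrite ge_min le_max ly orbT.
have := IHs a lo; have := IHs hi b.
rewrite /clip -/hi -/lo max_r; last by rewrite subr_ge0 ltW.
lra.
Qed.

Lemma pairwise_flatten (T : eqType) (J : eqType) (e : rel T) (f : J -> seq T)
    (s : seq J) :
  uniq s -> (forall j, pairwise e (f j)) ->
  (forall j j' x y, j != j' -> x \in f j -> y \in f j' -> e x y) ->
  pairwise e (flatten [seq f j | j <- s]).
Proof.
move=> + ef ff; elim: s => //= j s IHs /andP[js us].
rewrite pairwise_cat ef IHs // !andbT; apply/allrelP => x y xj.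
case/flatten_mapP => j' js' yj'; apply: ff xj yj'.
by apply: contraNneq js => ->.
Qed.

(** * Optimality *)

(** Busy time of processor [l] up to [tau]. The upper bound sees the pieces only through increments
    of this function between completion times. *)
Definition usage (R : realFieldType) (n m : nat) (S : schedule R n m)
    (l : 'I_m) (tau : R) : R :=
  \sum_j \sum_(x <- pieces S j l) clip 0 tau x.

Section Usage.
Variables (R : realFieldType) (I : instance R) (S : schedule_for I).
Hypothesis S_feasible : feasible S.

Lemma usage0 l : usage S l 0 = 0.
Proof.
apply: big1 => j _; apply: big1_seq => x /= xj; apply: max_l.
by rewrite subr_le0 ge_min !le_max lexx !orbT.
Qed.

Lemma usage_step l a b : 0 <= a -> a <= b ->
  0 <= usage S l b - usage S l a <= b - a.
Proof.
move=> a_ge0 ab; have -> : usage S l b - usage S l a =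
    \sum_j \sum_(x <- pieces S j l) clip a b x.
  rewrite /usage -sumrB; apply: eq_bigr => j _; rewrite -sumrB.
  apply: eq_big_seq => x /(feasible_nonempty S_feasible) x_lt.
  by rewrite (clip_cat a_ge0 ab x_lt) addrC addKr.
apply/andP; split.
  by apply: sumr_ge0 => j _; apply: sumr_ge0 => x _; apply: clip_ge0.
(* The pieces of all jobs on [l] form one disjoint family, so the window bounds them together. *)
have -> : \sum_j \sum_(x <- pieces S j l) clip a b x =
    \sum_(x <- flatten [seq pieces S j l | j <- enum 'I_(njobs I)]) clip a b x.
  by rewrite big_flatten /= big_map big_enum.
apply: sum_clip_le => // [x /flatten_mapP[j _]|].
  exact: (feasible_nonempty S_feasible).
apply: pairwise_flatten => [|j|j j' x y jj']; first exact: enum_uniq.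
  exact: (feasible_self S_feasible).
exact: (feasible_others S_feasible).
Qed.

Lemma sum_clip_completed j l tau : completion S j <= tau ->
  \sum_(x <- pieces S j l) clip 0 tau x = \sum_(x <- pieces S j l) (x.2 - x.1).
Proof.
move=> Ctau; apply: eq_big_seq => x xj.
have [x_ge0 x_le] := feasible_inside S_feasible xj.
by rewrite clip_id ?(le_trans x_le) // (feasible_nonempty S_feasible xj).
Qed.

Lemma overlap_length j l :
  overlap S j l = \sum_(x <- pieces S j l) (x.2 - x.1).
Proof. by rewrite -(sum_clip_completed l (lexx (completion S j))). Qed.

(** Reward and cost separate: pieces lie inside [(0, C_j)], so the overlap of a job is its whole
    shared length [p_j - C_j], while the cost depends on the processors and not on who uses them. *)
Lemma total_weighted_overlapE tau : (forall j, completion S j <= tau) ->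
  total_weighted_overlap S =
  \sum_j weight I j * (ptime I j - completion S j) -
  \sum_l cost I l * usage S l tau.
Proof.
move=> C_le; rewrite /total_weighted_overlap.
under eq_bigr do under eq_bigr do rewrite mulrBr overlap_length.
under eq_bigr do rewrite sumrB; rewrite sumrB exchange_big /=.
congr (_ - _); apply: eq_bigr => i _.
  by rewrite -mulr_suml -(feasible_total S_feasible) addrC addKr mulrC.
rewrite /usage mulr_sumr; apply: eq_bigr => j _.
by rewrite sum_clip_completed // mulrC.
Qed.

(** A job completed by [tau] has done all its shared work by then; the remaining jobs can only add
    usage. *)
Lemma usage_completed tau (sigma : {perm 'I_(njobs I)}) (r : nat) :
  (forall i : 'I_(njobs I), (i < r)%N -> completion S (sigma i) <= tau) ->
  \sum_(i < njobs I | (i < r)%N) (ptime I (sigma i) - completion S (sigma i))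
    <= \sum_l usage S l tau.
Proof.
move=> C_le; rewrite /usage exchange_big /= [X in _ <= X](reindex_inj (@perm_inj _ sigma)) /=.
rewrite big_mkcond /=; apply: ler_sum => i _; case: ifPn => ir; last first.
  by apply: sumr_ge0 => l _; apply: sumr_ge0 => x _; apply: clip_ge0.
rewrite -(feasible_total S_feasible) addrC addKr; apply: ler_sum => l _.
by rewrite sum_clip_completed ?C_le.
Qed.

Lemma usage_all tau : (forall j, completion S j <= tau) ->
  \sum_l usage S l tau = \sum_j (ptime I j - completion S j).
Proof.
move=> C_le; rewrite /usage exchange_big /=; apply: eq_bigr => j _.
rewrite -(feasible_total S_feasible) addrC addKr; apply: eq_bigr => l _.
by rewrite sum_clip_completed.
Qed.

End Usage.

Lemma sum_prefix_telescope (V : zmodType) (n r : nat) (f : nat -> V) :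
  (r <= n)%N -> \sum_(i < n | (i < r)%N) (f i.+1 - f i) = f r - f 0%N.
Proof.
move=> rn; rewrite -(big_ord_widen _ (fun i => f i.+1 - f i) rn).
by rewrite -(big_mkord xpredT (fun i => f i.+1 - f i)) telescope_sumr.
Qed.

(* [rho j] is the position of job [j]; [m], [u], [B] and [t] are indexed by
   positions. *)
Record greedy_schedule (R : realFieldType) (I : instance R)
    (S : schedule_for I) (rho : {perm 'I_(njobs I)}) (m : nat -> nat)
    (u B t : nat -> R) : Prop := GreedySchedule {
  gs_sorted : forall j j', (rho j <= rho j')%N -> ptime I j <= ptime I j';
  gs_count_le : forall j, (m (rho j) <= nprocs I)%N;
  gs_count : forall j (l : 'I_(nprocs I)), (l < m (rho j))%N = (cost I l <= u (rho j));
  gs_weight : forall j, weight I j = u (rho j) + (B (rho j) - B (rho j).+1);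
  gs_profit : forall j,
    B (rho j) = \sum_(l | cost I l <= u (rho j)) (u (rho j) - cost I l);
  gs_profit_last : B (njobs I) = 0;
  gs_t0 : t 0%N = 0;
  gs_t : forall j,
    t (rho j).+1 * (m (rho j)).+1%:R = ptime I j + (m (rho j))%:R * t (rho j);
  gs_completion : forall j, completion S j = t (rho j).+1;
  gs_pieces : forall j l, pieces S j l =
    if (l < m (rho j))%N && (t (rho j) < t (rho j).+1)
    then [:: (t (rho j), t (rho j).+1)] else [::]
}.

(** * Monotonicity, feasibility and optimality of the greedy schedule *)

Section GreedyOptimal.
Variables (R : realFieldType) (I : instance R) (S : schedule_for I).
Variables (rho : {perm 'I_(njobs I)}) (m : nat -> nat) (u B t : nat -> R).
Hypotheses (I_valid : valid I) (I_anti : antithetical I).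
Hypothesis gs : greedy_schedule S rho m u B t.

Local Notation n := (njobs I).

Lemma at_pos (i : 'I_n) : exists j, rho j = i.
Proof. by exists ((rho^-1)%g i); rewrite permKV. Qed.

Lemma profitE (i : 'I_n) : B i = \sum_l Num.max 0 (u i - cost I l).
Proof.
have [j <-] := at_pos i; rewrite (gs_profit gs) big_mkcond; apply: eq_bigr => l _.
case: ifPn => [h|]; first by rewrite max_r // subr_ge0.
by rewrite -ltNge => h; rewrite max_l // subr_le0 ltW.
Qed.

Lemma profit_le (i i' : 'I_n) : u i <= u i' -> B i <= B i'.
Proof.
move=> h; rewrite !profitE; apply: ler_sum => l _.
by rewrite ge_max !le_max lexx lerD2r h orbT.
Qed.

Lemma weight_pos_anti j j' : (rho j <= rho j')%N -> weight I j' <= weight I j.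
Proof. by move=> h; apply: I_anti; apply: (gs_sorted gs). Qed.

(** Backward induction. If [B i < B i.+1], then [u i > w_i >= w_(i+1) >= u i.+1], where the middle
    inequality is antitheticality and the last one the induction hypothesis; but profits increase
    with [u], a contradiction. *)
Lemma profit_step_ge0 (i : 'I_n) : B i.+1 <= B i.
Proof.
elim: {i}(n - i)%N {-2}i (leqnn (n - i)) => [|r IHr] i.
  by rewrite leqn0 subn_eq0 leqNgt ltn_ord.
have [ni _|ni hr] := leqP n i.+1.
  have -> : i.+1 = n by apply/eqP; rewrite eqn_leq ltn_ord.
  by rewrite (gs_profit_last gs) profitE sumr_ge0 // => l _; rewrite le_max lexx.
set i' := Ordinal ni; rewrite leNgt; apply/negP => lt_B.
have := IHr i' ltac:(rewrite /=; lia); rewrite [X in _ <= B X]/= => le_B'.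
have [[j ji] [j' ji']] := (at_pos i, at_pos i').
have := gs_weight gs j; have := gs_weight gs j'; rewrite ji ji' /= => wj' wj.
have /weight_pos_anti w_anti : (rho j <= rho j')%N by rewrite ji ji' /=.
have /profit_le /= : u i' <= u i by rewrite /=; lra.
lra.
Qed.

(** For neighbours, [u k < u k.+1] would give [B k <= B k.+1], hence
    [u k >= w_k >= w_(k+1) >= u k.+1]. *)
Lemma reduced_anti (i i' : 'I_n) : (i <= i')%N -> u i' <= u i.
Proof.
have step (k k' : 'I_n) : k' = k.+1 :> nat -> u k' <= u k.
  move=> ek; rewrite leNgt; apply/negP => lt_u.
  have := profit_le (ltW lt_u); have := profit_step_ge0 k'.
  have [[j jk] [j' jk']] := (at_pos k, at_pos k').
  have := gs_weight gs j; have := gs_weight gs j'; rewrite jk jk' -ek => wj' wj.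
  have /weight_pos_anti : (rho j <= rho j')%N by rewrite jk jk' ek.
  lra.
case: i' => i' lt_i'; elim: i' lt_i' => [|i' IH] lt_i'.
  by move=> h; have -> : i = Ordinal lt_i' by apply/val_inj/eqP; rewrite /= -leqn0.
rewrite leq_eqVlt => /orP[/eqP e|]; first by rewrite -e.
rewrite ltnS => h; apply: le_trans (IH (ltnW lt_i') h).
exact: (step (Ordinal (ltnW lt_i')) (Ordinal lt_i')).
Qed.

Lemma count_anti (i i' : 'I_n) : (i <= i')%N -> (m i' <= m i)%N.
Proof.
move=> ii'; have [[j ji] [j' ji']] := (at_pos i, at_pos i').
have m_le := gs_count_le gs j'; rewrite ji' in m_le.
rewrite leqNgt; apply/negP => lt_m; have lt_M := leq_trans lt_m m_le.
have := gs_count gs j (Ordinal lt_M); have := gs_count gs j' (Ordinal lt_M).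
rewrite ji ji' /= lt_m ltnn => /esym c_le /esym.
by rewrite (le_trans c_le) ?reduced_anti.
Qed.

(** The new time is the average of [p_j] and [m (rho j)] copies of the old time, so it lies between
    the two; later processing times are no smaller, so the invariant passes on. *)
Lemma times_bounds j :
  [/\ 0 <= t (rho j), t (rho j) <= t (rho j).+1 & t (rho j).+1 <= ptime I j].
Proof.
have from_le k : 0 <= t (rho k) <= ptime I k ->
    t (rho k) <= t (rho k).+1 <= ptime I k.
  move=> /andP[t0 tp].
  have := gs_t gs k; set q := t _.+1; rewrite -natr1.
  have : 0 <= (m (rho k))%:R :> R by [].
  move: (_%:R) => mR mR_ge0 e.
  have m1 : 0 < mR + 1 by lra.
  have mtp := ler_wpM2l mR_ge0 tp.
  by rewrite -(ler_pM2r m1 _ q) -(ler_pM2r m1 q) e; apply/andP; split; lra.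
suff base : 0 <= t (rho j) <= ptime I j.
  by have /andP[] := from_le j base; case/andP: base.
have [i] : {i | (rho j : nat) = i} by exists (rho j).
elim: i j => [|i IHi] j e.
  by rewrite e (gs_t0 gs) lexx; have [_ ->] := I_valid.
have lt_i : (i < n)%N by rewrite ltnW // -e.
have [k /(congr1 val)/= rk] := at_pos (Ordinal lt_i).
have IH := IHi _ rk; have /andP[le1 le2] := from_le _ IH.
rewrite rk in IH le1 le2; rewrite e.
have /andP[t_ge0 _] := IH.
rewrite (le_trans t_ge0 le1) /= (le_trans le2) //.
by apply: (gs_sorted gs); rewrite rk e.
Qed.

Lemma times_mono i i' : (i <= i' <= n)%N -> t i <= t i'.
Proof.
elim: i' => [|i' IH]; first by rewrite leqn0 => /andP[/eqP-> _].
rewrite leq_eqVlt => /andP[/orP[/eqP-> //|ii'] lt_i'].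
apply: (le_trans (IH _)); first by rewrite -ltnS ii' ltnW.
have [k /(congr1 val)/= <-] := at_pos (Ordinal lt_i').
by have [] := times_bounds k.
Qed.

Lemma sum_pieces j l (F : R * R -> R) :
  \sum_(x <- pieces S j l) F x =
  if (l < m (rho j))%N && (t (rho j) < t (rho j).+1)
  then F (t (rho j), t (rho j).+1) else 0.
Proof. by rewrite (gs_pieces gs); case: ifP; rewrite ?big_nil ?big_seq1. Qed.

Lemma sum_count j (a : R) :
  \sum_(l < nprocs I) (if (l < m (rho j))%N then a else 0) = a *+ m (rho j).
Proof.
rewrite -big_mkcond /=.
by rewrite -(big_ord_widen _ (fun=> a) (gs_count_le gs j)) sumr_const card_ord.
Qed.

Lemma greedy_length j l :
  \sum_(x <- pieces S j l) (x.2 - x.1) =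
  if (l < m (rho j))%N then t (rho j).+1 - t (rho j) else 0.
Proof.
rewrite sum_pieces; case: ltnP => //= _; case: ifPn => //.
have [_ t_le _] := times_bounds j.
by rewrite -leNgt => t_ge; apply/esym/eqP; rewrite subr_eq0 eq_le t_ge.
Qed.

Lemma mem_pieces j l x : x \in pieces S j l ->
  [/\ (l < m (rho j))%N, t (rho j) < t (rho j).+1 &
      x = (t (rho j), t (rho j).+1)].
Proof.
by rewrite (gs_pieces gs); case: ifP => // /andP[? ?]; rewrite inE => /eqP.
Qed.

Lemma greedy_feasible : feasible S.
Proof.
split.
- move=> j; rewrite (gs_completion gs); have [t0 t1 _] := times_bounds j.
  exact: le_trans t1.
- by move=> j l x /mem_pieces[_ ? ->].
- by move=> j l; rewrite (gs_pieces gs); case: ifP.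
- move=> j; under eq_bigr do rewrite greedy_length.
  rewrite sum_count (gs_completion gs); have := gs_t gs j.
  rewrite -natr1 -mulr_natl; lra.
- move=> j j' l x y jj' /mem_pieces[_ _ ->] /mem_pieces[_ _ ->].
  rewrite /itv_disjoint /=.
  have : rho j != rho j' :> nat by apply: contra_neq jj' => /val_inj/perm_inj.
  rewrite neq_ltn => /orP[] h; apply/orP; [left|right];
  by apply: times_mono; rewrite h ltnW.
- move=> j l x /mem_pieces[_ _ ->]; rewrite (gs_completion gs).
  by have [] := times_bounds j.
Qed.

Lemma greedy_value :
  total_weighted_overlap S =
  \sum_j (B (rho j) - B (rho j).+1) * ptime I j.
Proof.
rewrite /total_weighted_overlap exchange_big /=.
have ov j l : overlap S j l = if (l < m (rho j))%N then t (rho j).+1 - t (rho j) else 0.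
  rewrite -greedy_length; apply: eq_big_seq => x /mem_pieces[_ h ->] /=.
  have [t0 _ _] := times_bounds j.
  by rewrite (gs_completion gs) (min_l (lexx _)) (max_l t0) max_r // subr_ge0 ltW.
under eq_bigr do under eq_bigr do rewrite ov.
have job (j : 'I_n) : \sum_(l < nprocs I) (if (l < m (rho j))%N then t (rho j).+1 - t (rho j) else 0) *
      (weight I j - cost I l) =
    (B (rho j) - B (rho j).+1) * ptime I j +
    (t (rho j).+1 * B (rho j).+1 - t (rho j) * B (rho j)).
  set d := _ - t (rho j).
  (* Split [w_j - c_l] into [u - c_l], whose sum over the used processors is [B (rho j)], and the
     constant [B (rho j) - B (rho j).+1]. *)
  have -> : \sum_(l < nprocs I) (if (l < m (rho j))%N then d else 0) * (weight I j - cost I l) =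
      d * B (rho j) + (B (rho j) - B (rho j).+1) * (d *+ m (rho j)).
    rewrite -sum_count {1}(gs_profit gs) [\sum_(l | _ <= _) _]big_mkcond !mulr_sumr -big_split /=.
    apply: eq_bigr => l _; rewrite -(gs_count gs) (gs_weight gs).
    by case: ifP => _; ring.
  have := gs_t gs j; rewrite -natr1 -(mulr_natl d) /d => e.
  have -> : ptime I j = t (rho j).+1 * ((m (rho j))%:R + 1) - (m (rho j))%:R * t (rho j).
    by rewrite e; ring.
  ring.
under eq_bigr do rewrite job.
rewrite big_split /= [X in _ + X](_ : _ = 0) ?addr0 //.
rewrite -(reindex_inj (@perm_inj _ rho) (P := xpredT)
  (F := fun i : 'I_n => t i.+1 * B i.+1 - t i * B i)) /=.
rewrite -(big_mkord xpredT (fun i => t i.+1 * B i.+1 - t i * B i)).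
by rewrite telescope_sumr // (gs_profit_last gs) (gs_t0 gs) mulr0 mul0r subrr.
Qed.

(* The completion times are only constrained through their sorted sequence [D]:
   by rearrangement it may be assumed that the jobs complete in the order of
   their positions, and jobs completed by [D r] fit in (0, [D r]). *)
Lemma greedy_bound (S' : schedule_for I) : feasible S' ->
  total_weighted_overlap S' <= \sum_j (B (rho j) - B (rho j).+1) * ptime I j.
Proof.
move=> S'_feas; have [tau0 tau0_sorted] := exists_sorting_perm (completion S').
pose tau := (tau0^-1)%g; pose sigma := (rho^-1)%g.
have C_sorted (i i' : 'I_n) : (i <= i')%N ->
    completion S' (tau i) <= completion S' (tau i').
  by move=> h; apply: tau0_sorted; rewrite !permKV.
have p_sorted (i i' : 'I_n) : (i <= i')%N ->
    ptime I (sigma i) <= ptime I (sigma i').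
  by move=> h; apply: (gs_sorted gs); rewrite !permKV.
(* Shifted by one, so that [D 0] is the origin of time. [tau] lists the jobs by completion in [S'],
   [sigma] by position. *)
pose D k := if k is k'.+1 then table (completion S' \o tau) k' else 0.
have DS (i : 'I_n) : D i.+1 = completion S' (tau i) by rewrite /D tableE.
have C_ge0 := feasible_completion S'_feas.
have D_step k : (k < n)%N -> D k <= D k.+1.
  move=> kn; rewrite (DS (Ordinal kn)); case: k => [|k] //= in kn *.
  by rewrite (tableE _ (Ordinal (ltnW kn))) C_sorted /=.
have D_ge0 k : (k <= n)%N -> 0 <= D k.
  by case: k => // k kn; rewrite (DS (Ordinal kn)).
have D_last j : completion S' j <= D n.
  have [i ->] : exists i, j = tau i by exists (tau0 j); rewrite permK.
  have n_gt0 : (0 < n)%N := leq_ltn_trans (leq0n i) (ltn_ord i).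
  have kn : (n.-1 < n)%N by rewrite prednK.
  have -> : D n = completion S' (tau (Ordinal kn)) by rewrite -DS (prednK n_gt0).
  by rewrite C_sorted //= -ltnS prednK.
have reindex_pos (F : 'I_n -> R) : \sum_j F j = \sum_i F (sigma i).
  by rewrite (reindex_inj (@perm_inj _ sigma)).
pose z (l : 'I_(nprocs I)) (i : 'I_n) := usage S' l (D i.+1) - usage S' l (D i).
have z_prefix r : (r <= n)%N ->
    \sum_(i < n | (i < r)%N) \sum_l z l i = \sum_l usage S' l (D r).
  move=> rn; rewrite exchange_big /=; apply: eq_bigr => l _.
  by rewrite (sum_prefix_telescope (fun i => usage S' l (D i)) rn) usage0 subr0.
have all_pos (F : 'I_n -> R) : \sum_i F i = \sum_(i < n | (i < n)%N) F i.
  by apply: eq_bigl => i; rewrite ltn_ord.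
(* Heavier jobs come first, so giving them the smaller completion times lowers the loss. *)
have swap_le : \sum_i weight I (sigma i) * completion S' (tau i) <=
               \sum_i weight I (sigma i) * completion S' (sigma i).
  apply: abel_ler_sum => [i i' h|r _|].
  - by apply: weight_pos_anti; rewrite !permKV.
  - exact: sum_sorted_prefix_le.
  - by rewrite -reindex_pos [RHS](reindex_inj (@perm_inj _ tau)).
(* For each prefix, the [r] shortest jobs require no more than the first [r] jobs to complete, whose
   shared work is all done by [D r]. *)
have usage_le : \sum_(i < n) u i * (ptime I (sigma i) - completion S' (tau i)) <=
                \sum_(i < n) u i * \sum_l z l i.
  apply: abel_ler_sum => [|r rn|]; first exact: reduced_anti.
  - rewrite z_prefix //; apply: (@le_trans _ _
      (\sum_(i < n | (i < r)%N) (ptime I (tau i) - completion S' (tau i)))).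
      by rewrite !sumrB lerD2r; apply: sum_sorted_prefix_le.
    apply: usage_completed => // i ir; case: r rn ir => // r rn ir.
    by rewrite (DS (Ordinal rn)) C_sorted.
  - rewrite [RHS]all_pos z_prefix // usage_all // !sumrB -reindex_pos.
    by rewrite [in RHS](reindex_inj (@perm_inj _ tau) (F := completion S')).
have gain_le : \sum_(i < n) \sum_l (u i - cost I l) * z l i <=
               \sum_(i < n) B i * (D i.+1 - D i).
  apply: ler_sum => i _; rewrite profitE mulr_suml; apply: ler_sum => l _.
  have /andP[z_ge0 z_le] :=
    usage_step S'_feas l (D_ge0 _ (ltnW (ltn_ord i))) (D_step _ (ltn_ord i)).
  apply: (@le_trans _ _ (Num.max 0 (u i - cost I l) * z l i)).
    by apply: ler_wpM2r => //; rewrite le_max lexx orbT.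
  by apply: ler_wpM2l => //; rewrite le_max lexx.
have W i : weight I (sigma i) = u i + (B i - B i.+1).
  by rewrite (gs_weight gs) permKV.
have cost_usage : \sum_l cost I l * usage S' l (D n) =
    \sum_(i < n) \sum_l cost I l * z l i.
  rewrite exchange_big /=; apply: eq_bigr => l _; rewrite -mulr_sumr; congr (_ * _).
  rewrite all_pos.
  by rewrite (sum_prefix_telescope (fun i => usage S' l (D i)) (leqnn n)) usage0 subr0.
have D_telescope : \sum_(i < n) (D i.+1 * B i.+1 - D i * B i) = 0.
  rewrite all_pos (sum_prefix_telescope (fun i => D i * B i) (leqnn n)).
  by rewrite (gs_profit_last gs) mulr0 mul0r subrr.
rewrite (total_weighted_overlapE S'_feas D_last) cost_usage [X in X - _ <= _]reindex_pos [X in _ <= X]reindex_pos.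
have -> : \sum_i (B (rho (sigma i)) - B (rho (sigma i)).+1) * ptime I (sigma i) =
    \sum_(i < n) (B i - B i.+1) * ptime I (sigma i).
  by apply: eq_bigr => i _; rewrite permKV.
have split_gain : \sum_(i < n) u i * \sum_l z l i =
    \sum_(i < n) \sum_l (u i - cost I l) * z l i + \sum_(i < n) \sum_l cost I l * z l i.
  rewrite -big_split; apply: eq_bigr => i _ /=; rewrite mulr_sumr -big_split /=.
  by apply: eq_bigr => l _; ring.
(* A termwise identity after substituting [W]. Since the telescoping sum vanishes, the resulting
   bound no longer depends on [S']. *)
have final : \sum_(i < n) (B i - B i.+1) * ptime I (sigma i) =
    \sum_(i < n) weight I (sigma i) * ptime I (sigma i)
    - \sum_(i < n) weight I (sigma i) * completion S' (tau i)
    - \sum_(i < n) u i * (ptime I (sigma i) - completion S' (tau i))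
    + \sum_(i < n) B i * (D i.+1 - D i) - \sum_(i < n) (D i.+1 * B i.+1 - D i * B i).
  rewrite -!sumrB -big_split -sumrB /=; apply: eq_bigr => i _.
  by rewrite W !tableE /=; ring.
under eq_bigr do rewrite mulrBr.
rewrite sumrB final D_telescope; lra.
Qed.

Lemma greedy_optimal : optimal S.
Proof.
by split=> [|S' /greedy_bound h]; [apply: greedy_feasible | rewrite greedy_value].
Qed.

Lemma greedy_optimal_synchronized : optimal_synchronized S.
Proof.
split; first exact: greedy_optimal.
pose sigma := (rho^-1)%g.
(* The counts are nonincreasing, so the present jobs fill an initial segment of positions, ending at
   the first zero count. *)
have [k kn present] : exists2 k, (k <= n)%N & forall i : 'I_n, (i < k)%N = (0 < m i)%N.
  exists (find (fun i => m i == 0%N) (iota 0 n)).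
    by rewrite -[X in (_ <= X)%N](size_iota 0) find_size.
  move=> i; set k := find _ _; apply/idP/idP => [ik|].
    have := before_find 0%N ik; rewrite nth_iota // add0n lt0n => /negbT.
    exact.
  rewrite lt0n; apply: contraNT; rewrite -leqNgt => ki.
  have kn : (k < n)%N by apply: leq_ltn_trans ki _.
  have := nth_find 0%N (a := fun i => m i == 0%N) (s := iota 0 n).
  rewrite has_find size_iota => /(_ kn); rewrite -/k nth_iota // add0n => /eqP mk0.
  by have := @count_anti (Ordinal kn) i ki; rewrite /= mk0 leqn0.
pose js i := sigma (widen_ord kn i).
exists k, js, m, t.
have rho_js i : rho (js i) = i :> nat by rewrite permKV.
split.
- split.
  + exact: greedy_feasible.
  + by move=> i i' /perm_inj/(congr1 val)/= /val_inj.
  + exact: (gs_t0 gs).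
  + by move=> i; rewrite -(rho_js i); have [] := times_bounds (js i).
  + move=> i; rewrite -{2}(rho_js i) (gs_count_le gs) andbT.
    by have := present (widen_ord kn i); rewrite /= ltn_ord => <-.
  + by move=> i i' ii'; apply: (@count_anti (widen_ord kn i) (widen_ord kn i')).
  + move=> j absent; have m0 : m (rho j) = 0%N.
      apply/eqP; rewrite -leqn0 leqNgt -present; apply/negP => lt_k.
      apply: (absent (Ordinal lt_k)); rewrite /js -[RHS](permK rho).
      by congr (_ _); apply: val_inj.
    split=> [|l]; last by rewrite (gs_pieces gs) m0.
    have := gs_t gs j; rewrite (gs_completion gs) m0 mulr1 mul0r addr0; exact.
  + move=> i l x; rewrite /executes (gs_pieces gs) rho_js.
    case: ltnP => //= _; case: ltP => [|t_le] /=; first by rewrite orbF.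
    by apply/esym/negP => /andP[xt tx]; have := lt_trans xt tx; rewrite ltNge t_le.
  + by move=> i; rewrite (gs_completion gs) rho_js.
- by move=> i i' ii'; apply: (gs_sorted gs); rewrite !rho_js.
- move=> j [l lw]; suff lt_k : (rho j < k)%N.
    exists (Ordinal lt_k); rewrite /js -[RHS](permK rho).
    by congr (_ _); apply: val_inj.
  (* A job using no processor has profit slope 0, so [u] is its weight plus a nonnegative
     [B (rho j).+1]; this reaches [cost I l], and the count could not be 0. *)
  rewrite present lt0n; apply/negP => /eqP m0.
  have uc l' : (cost I l' <= u (rho j)) = false by rewrite -(gs_count gs) m0.
  have B0 : B (rho j) = 0 by rewrite (gs_profit gs) big_pred0.
  have := profit_step_ge0 (rho j); have := gs_weight gs j; rewrite B0.
  have B1 : 0 <= B (rho j).+1.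
    have [n1|n1] := leqP n (rho j).+1.
      have -> : (rho j).+1 = n by apply/eqP; rewrite eqn_leq n1 ltn_ord.
      by rewrite (gs_profit_last gs).
    rewrite (profitE (Ordinal n1)); apply: sumr_ge0 => l' _.
    by rewrite le_max lexx.
  move=> e ?; have : cost I l <= u (rho j) by lra.
  by rewrite uc.
Qed.

End GreedyOptimal.

(** * Construction *)

Section Construction.
Variables (R : realFieldType) (c : nat -> R) (m : nat).

(* Solves [u + sum_l max 0 (u - c l) = V]: the solution is
   [u = (V + s) / (k + 1)], where [k] counts the [l] with [c l <= u] and [s] is
   the sum of their [c l]; a candidate [u] decreases to the solution as the
   cheapest processors are added one by one. *)
Fixpoint fill (V : R) (l : nat) : R * nat :=
  if l is l'.+1 then
    let: (s, k) := fill V l' in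
    if c l' <= (V + s) / k.+1%:R then (s + c l', k.+1) else (s, k)
  else (0, 0%N).

Definition reduced (V : R) : R := (V + (fill V m).1) / (fill V m).2.+1%:R.

Lemma fill_count_le V l : ((fill V l).2 <= l)%N.
Proof. by elim: l => //= l; case: fill => s k /= kl; case: ifP => //= _; apply: leqW. Qed.

(** An accepted cost turns the candidate into a weighted average of the candidate and that cost,
    hence still at least that cost and all earlier ones. As costs are sorted, acceptance of [M]
    forces acceptance of all its predecessors, so the count is a prefix. *)
Lemma fillP V :
  (forall l l', (l <= l' < m)%N -> c l <= c l') ->
  (fill V m).1 = \sum_(0 <= l < (fill V m).2) c l /\
  forall l, (l < m)%N -> (l < (fill V m).2)%N = (c l <= reduced V).
Proof.
rewrite /reduced; elim: m => [|M IH] c_mono.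
  by split=> //; rewrite big_geq.
have [] := IH (fun l l' h => c_mono l l' ltac:(lia)).
have := fill_count_le V M; rewrite /=; case: fill => s k /= kM sE kP.
case: (leP (c M)) => cM /=; last first.
  split=> // l; rewrite ltnS leq_eqVlt => /orP[/eqP->|/kP//].
  by rewrite ltnNge kM leNgt cM.
have kM' : k = M.
  apply/eqP; rewrite eqn_leq kM leqNgt; apply/negP => lt_kM.
  have := kP k lt_kM; rewrite ltnn => /esym/negP; apply; apply: le_trans cM.
  by apply: c_mono; lia.
split; first by rewrite sE big_nat_recr //= kM'.
move=> l lt_l; rewrite kM' lt_l; apply/esym.
apply: (@le_trans _ _ (c M)); first by apply: c_mono; lia.
move: cM; rewrite !ler_pdivlMr ?ltr0n // kM' -[M.+2%:R]natr1 mulrDr mulr1.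
by lra.
Qed.

(* [w r] is the weight of the job in position [n - 1 - r].  The value equals
   [V - reduced V], but written this way [profit w r'] occurs only once, so that
   its bit length grows additively with [r]. *)
Fixpoint profit (w : nat -> R) (r : nat) : R :=
  if r is r'.+1 then
    let V := w r' + profit w r' in
    let: (s, k) := fill V m in (k%:R * V - s) / k.+1%:R
  else 0.

Definition count_at (w : nat -> R) (r : nat) : nat :=
  (fill (w r + profit w r) m).2.

Fixpoint time_at (p : nat -> R) (k : nat -> nat) (i : nat) : R :=
  if i is i'.+1 then
    (p i' + (k i')%:R * time_at p k i') / (k i').+1%:R
  else 0.

Lemma profit_reduced w r :
  profit w r.+1 = w r + profit w r - reduced (w r + profit w r).
Proof.
rewrite /= /reduced; case: fill => s k /=.
by have := ltr0Sn R k; rewrite -natr1 => k1; field; rewrite lt0r_neq0.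
Qed.

End Construction.

(** The second test drops degenerate slots, because a feasible schedule has only nonempty
    intervals. *)
Definition consecutive_schedule (R : realFieldType) (n m : nat)
    (rho : 'I_n -> nat) (k : nat -> nat) (t : nat -> R) : schedule R n m :=
  Schedule (fun j => t (rho j).+1)
    (fun j l => if (l < k (rho j))%N && (t (rho j) < t (rho j).+1)
                then [:: (t (rho j), t (rho j).+1)] else [::]).

(** Only the values of [p], [w], [c] and [k] at actual positions are prescribed, so this serves both
    existence over any field and the functions that the program computes. *)
Lemma fill_greedy_schedule (R : realFieldType) (I : instance R)
    (rho : {perm 'I_(njobs I)}) (p w c : nat -> R) (k : nat -> nat) :
  valid I ->
  (forall j j', (rho j <= rho j')%N -> ptime I j <= ptime I j') ->
  (forall j, p (rho j) = ptime I j) ->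
  (forall j, w ((njobs I).-1 - rho j)%N = weight I j) ->
  (forall l : 'I_(nprocs I), c l = cost I l) ->
  (forall i, (i < njobs I)%N -> k i = count_at c (nprocs I) w ((njobs I).-1 - i)) ->
  exists u B, greedy_schedule
    (consecutive_schedule (nprocs I) (fun j => rho j) k (time_at p k) : schedule_for I)
    rho k u B (time_at p k).
Proof.
move=> [m_gt0 _ _ c_mono] sorted pE wE cE kE.
set n := njobs I in rho sorted pE wE kE *; set m := nprocs I in c_mono cE kE *.
pose V i := w (n.-1 - i)%N + profit c m w (n.-1 - i).
exists (fun i => reduced c m (V i)), (fun i => profit c m w (n - i)).
have n_pos (j : 'I_n) : (n - rho j)%N = (n.-1 - rho j).+1 by have := ltn_ord (rho j); lia.
have k_pos (j : 'I_n) : k (rho j) = (fill c (V (rho j)) m).2 by rewrite kE.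
have mono l l' : (l <= l' < m)%N -> c l <= c l'.
  move=> /andP[ll' l'm]; have lm := leq_ltn_trans ll' l'm.
  by rewrite (cE (Ordinal lm)) (cE (Ordinal l'm)); apply: c_mono.
have next j : (n - (rho j).+1)%N = (n.-1 - rho j)%N by lia.
split=> //.
- by move=> j; rewrite k_pos fill_count_le.
- by move=> j l; rewrite k_pos -cE; apply: (fillP _ mono).2.
- move=> j; rewrite n_pos profit_reduced next -/(V _) /V wE; ring.
- move=> j; rewrite n_pos /= -/(V _).
  have [sumE countE] := fillP (V (rho j)) mono.
  have -> : \sum_(l < m | cost I l <= reduced c m (V (rho j)))
      (reduced c m (V (rho j)) - cost I l) =
      \sum_(l < (fill c (V (rho j)) m).2) (reduced c m (V (rho j)) - c l).
    rewrite (big_ord_widen _ (fun l => reduced c m (V (rho j)) - c l)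
      (fill_count_le c (V (rho j)) m)).
    by apply: eq_big => l; rewrite -?cE ?countE.
  rewrite sumrB sumr_const card_ord -(big_mkord xpredT c) -sumE /reduced.
  case: fill => s k' /=; rewrite -mulr_natr -[k'.+1%:R]natr1.
  by have := ltr0Sn R k'; rewrite -natr1 => k1; field; rewrite lt0r_neq0.
- by rewrite subnn.
- by move=> j; rewrite /= mulfVK ?pnatr_eq0 // pE.
Qed.

(** [ratr] reflects comparisons as well as preserving them, so the processors selected by [u] and
    the guards on pieces do not change. *)
Lemma greedy_schedule_map (R : realFieldType) (I : instance rat)
    (S : schedule_for I) (rho : {perm 'I_(njobs I)}) (k : nat -> nat)
    (u B t : nat -> rat) (f := ratr : rat -> R) :
  greedy_schedule S rho k u B t ->
  greedy_schedule (I := map_instance f I) (map_schedule f S)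
    rho k (f \o u) (f \o B) (f \o t).
Proof.
rewrite /f => -[sorted k_le kE wE BE Bn t0 tE CE piecesE].
split=> //=.
- by move=> j j' h; rewrite ler_rat sorted.
- by move=> j l; rewrite ler_rat.
- by move=> j; rewrite wE rmorphD rmorphB.
- move=> j; rewrite BE rmorph_sum; apply: eq_big => l; first by rewrite ler_rat.
  by rewrite rmorphB.
- by rewrite Bn rmorph0.
- by rewrite t0 rmorph0.
- move=> j; have := congr1 (ratr : rat -> R) (tE j).
  by rewrite rmorphD !rmorphM /= !ratr_nat.
- by move=> j; rewrite CE.
- by move=> j l; rewrite piecesE ltr_rat; case: ifP.
Qed.

Lemma valid_map (R : realFieldType) (I : instance rat) :
  valid I -> valid (map_instance (ratr : rat -> R) I).
Proof.
case=> m_gt0 p_ge0 w_ge0 c_mono; split=> //= [j|j|l l' ll']; rewrite ?ler0q //.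
by rewrite ler_rat c_mono.
Qed.

Lemma antithetical_map (R : realFieldType) (I : instance rat) :
  antithetical I -> antithetical (map_instance (ratr : rat -> R) I).
Proof. by move=> anti j j' /=; rewrite !ler_rat; apply: anti. Qed.

Lemma optimal_synchronized_exists (R : realFieldType) (I : instance R) :
  valid I -> antithetical I -> exists S : schedule_for I, optimal_synchronized S.
Proof.
move=> I_valid I_anti; have [rho sorted] := exists_sorting_perm (ptime I).
pose w i := table (fun i => weight I ((rho^-1)%g i)) ((njobs I).-1 - i).
pose c := table (cost I).
pose k i := count_at c (nprocs I) w ((njobs I).-1 - i).
pose p := table (fun i => ptime I ((rho^-1)%g i)).
have := @fill_greedy_schedule _ I rho p w c k I_valid sorted.
case=> [j|j|l|//|u [B gs]].
- by rewrite /p tableE permK.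
- rewrite /w; have -> : ((njobs I).-1 - ((njobs I).-1 - rho j))%N = rho j.
    by have := ltn_ord (rho j); lia.
  by rewrite tableE permK.
- exact: tableE.
by eexists; apply: (greedy_optimal_synchronized I_valid I_anti gs).
Qed.

(** * Bit lengths and running time *)

(** Any fraction representing [x] is allowed, not only the reduced one: such bounds compose under
    arithmetic, and reduction only shortens. *)
Definition fits (k : nat) (x : rat) : Prop :=
  exists (a : int) (d : nat),
    [/\ (0 < d)%N, (`|a|%N <= 2 ^ k)%N, (d <= 2 ^ k)%N & x = a%:~R / d%:R].

Lemma fits_le k k' x : (k <= k')%N -> fits k x -> fits k' x.
Proof.
move=> kk' [a [d [d_gt0 ak dk ->]]]; exists a, d; split=> //;
  by rewrite (leq_trans _ (leq_pexp2l _ kk')).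
Qed.

Lemma natbits_le k i : (i <= 2 ^ k)%N -> (natbits i <= k.+1)%N.
Proof. by move=> /(leq_trunc_log 2); rewrite trunc_expnK. Qed.

(** Reduction divides out a common factor; numerator and denominator then take [k + 1] bits each,
    and one more is charged for the sign. *)
Lemma fits_ratbits k x : fits k x -> (ratbits x <= k.*2 + 3)%N.
Proof.
case=> a [d [d_gt0 ak dk ->]]; rewrite /ratbits.
rewrite pmulrn.
have : (`|(d : int)|%N <= 2 ^ k)%N by [].
case: divqP ak => [_|c x' c0]; first by rewrite addn3.
rewrite !abszM => ak dk'.
have c_gt0 : (0 < `|c|)%N by rewrite absz_gt0.
have := natbits_le (leq_trans (leq_pmull _ c_gt0) ak).
have := natbits_le (leq_trans (leq_pmull _ c_gt0) dk').
by rewrite -addnn; lia.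
Qed.

Lemma ratbits_fits x : fits (ratbits x) x.
Proof.
exists (numq x), `|denq x|%N; rewrite absz_gt0 denq_neq0.
have lt_bits i : (i < 2 ^ natbits i)%N by apply: trunc_log_ltn.
have le_bits i : (natbits i <= ratbits x)%N -> (i <= 2 ^ ratbits x)%N.
  by move=> h; apply: leq_trans (ltnW (lt_bits i)) _; rewrite leq_pexp2l.
split=> //; try by apply: le_bits; rewrite /ratbits; lia.
by rewrite pmulrn absz_denq divq_num_den.
Qed.

Lemma fits_nat i : fits i i%:R.
Proof.
exists i, 1%N; split=> //; [exact/ltnW/ltn_expl | by rewrite expn_gt0 |].
by rewrite divr1 pmulrn.
Qed.

Lemma fits_opp k x : fits k x -> fits k (- x).
Proof.
by case=> a [d [? ? ? ->]]; exists (- a), d; rewrite abszN mulrNz mulNr.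
Qed.

Lemma fits_add k k' x y : fits k x -> fits k' y -> fits (k + k').+1 (x + y).
Proof.
case=> [a [d [d_gt0 ak dk ->]]] [b [e [e_gt0 bk ek ->]]].
have prod_le i j : (i <= 2 ^ k -> j <= 2 ^ k' -> i * j <= 2 ^ (k + k'))%N.
  by move=> ik jk; rewrite expnD leq_mul.
have absD (i j : int) : (absz (i + j)%R <= absz i + absz j)%N by lia.
exists (a * (e : int) + b * (d : int)), (d * e)%N; split.
- by rewrite muln_gt0 d_gt0.
- rewrite expnS mul2n -addnn (leq_trans (absD _ _)) // !abszM !absz_nat.
  by apply: leq_add; [apply: prod_le | rewrite mulnC; apply: prod_le].
- by rewrite (leq_trans (prod_le _ _ dk ek)) // leq_pexp2l.
- have d0 : d%:R != 0 :> rat by rewrite pnatr_eq0 -lt0n.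
  have e0 : e%:R != 0 :> rat by rewrite pnatr_eq0 -lt0n.
  rewrite intrD !intrM -!pmulrn natrM; field.
  by rewrite e0 d0.
Qed.

Lemma fits_sub k k' x y : fits k x -> fits k' y -> fits (k + k').+1 (x - y).
Proof. by move=> fx fy; apply: fits_add => //; apply: fits_opp. Qed.

(** Charging [i] bits for a factor [i] is crude but sufficient: the factors are processor counts,
    bounded by the length of the input. *)
Lemma fits_natmul i k x : fits k x -> fits (i + k) (i%:R * x).
Proof.
case=> a [d [d_gt0 ak dk ->]]; exists ((i : int) * a), d; split=> //.
- by rewrite abszM expnD leq_mul // ltnW // ltn_expl.
- by rewrite (leq_trans dk) // leq_pexp2l // leq_addl.
- by rewrite rmorphM /= mulrA.
Qed.

Lemma fits_natdiv i k x : fits k x -> fits (i.+1 + k) (x / i.+1%:R).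
Proof.
case=> a [d [d_gt0 ak dk ->]]; exists a, (i.+1 * d)%N; split; first by rewrite muln_gt0.
- by rewrite (leq_trans ak) // leq_pexp2l // leq_addl.
- by rewrite expnD leq_mul // ltnW // ltn_expl.
- by rewrite natrM invfM mulrA mulrAC.
Qed.

(** * Proof rules for runs with bounded cost *)

Definition bounded (W : nat) (s : state) : Prop :=
  (forall i, (ratbits (registers s i) <= W)%N) /\
  (forall i, (ratbits (memory s i) <= W)%N).

(* [N] counts elementary steps: a step involves at most three quantities, each
   of bit length at most [W]. *)
Definition run (W : nat) (c : cmd) (s : state) (N : nat) (Q : state -> Prop)
    : Prop :=
  bounded W s -> exists s' T,
    [/\ exec c s s' T, (T <= N * (3 * W))%N, bounded W s' & Q s'].

Section Run.
Variable W : nat.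
Implicit Types (s : state) (Q : state -> Prop) (N : nat).

Lemma ratbits_gt0 x : (0 < ratbits x)%N.
Proof. by []. Qed.

Lemma natbits_ratbits i : (natbits i <= ratbits i%:R)%N.
Proof.
by rewrite pmulrn /ratbits numq_int absz_nat; lia.
Qed.

Lemma bounded_update s d x : bounded W s -> (ratbits x <= W)%N ->
  bounded W (State (update (registers s) d x) (memory s) (out s)).
Proof. by case=> rW mW xW; split=> //= i; rewrite /update; case: ifP. Qed.

Lemma run_skip s N Q : Q s -> run W Skip s N.+1 Q.
Proof.
move=> Qs bs; exists s, 1%N; split=> //; first exact: ExecSkip.
by have := leq_trans (ratbits_gt0 _) (bs.1 0%N); lia.
Qed.

Lemma run_seq c1 c2 s N1 N2 N Q1 Q :
  run W c1 s N1 Q1 -> (forall s1, Q1 s1 -> run W c2 s1 N2 Q) ->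
  (N1 + N2 <= N)%N -> run W (Seq c1 c2) s N Q.
Proof.
move=> run1 run2 leN bs; have [s1 [T1 [e1 T1le bs1 Q1s]]] := run1 bs.
have [s2 [T2 [e2 T2le bs2 Qs]]] := run2 _ Q1s bs1.
exists s2, (T1 + T2)%N; split=> //; first exact: ExecSeq e1 e2.
by apply: leq_trans (leq_mul leN (leqnn _)); rewrite mulnDl leq_add.
Qed.

Lemma run_step c1 c2 s N Q :
  run W c1 s 1 (fun s1 => run W c2 s1 N Q) -> run W (Seq c1 c2) s N.+1 Q.
Proof. by move=> h; apply: (run_seq (N2 := N) h). Qed.

Lemma run_const d q s Q : (ratbits q <= W)%N ->
  Q (State (update (registers s) d q) (memory s) (out s)) ->
  run W (Const d q) s 1 Q.
Proof.
move=> qW Qs bs; do 2!eexists; split; first exact: ExecConst.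
- lia.
- exact: bounded_update.
- exact: Qs.
Qed.

Lemma run_arith o d a b s Q z :
  eval_arith o (registers s a) (registers s b) = z -> (ratbits z <= W)%N ->
  Q (State (update (registers s) d z) (memory s) (out s)) ->
  run W (Arith o d a b) s 1 Q.
Proof.
move=> zE zW Qs bs; do 2!eexists; split; first exact: (ExecArith _ erefl erefl zE).
- by have := bs.1 a; have := bs.1 b; lia.
- exact: bounded_update.
- exact: Qs.
Qed.

Lemma run_fetch d a s Q (i : nat) x : registers s a = i%:R -> memory s i = x ->
  Q (State (update (registers s) d x) (memory s) (out s)) ->
  run W (Fetch d a) s 1 Q.
Proof.
move=> aE xE Qs bs; have xW := bs.2 i; rewrite xE in xW.
do 2!eexists; split; first exact: (ExecFetch _ aE xE).
- by have := bs.1 a; rewrite aE; have := natbits_ratbits i; lia.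
- exact: bounded_update.
- exact: Qs.
Qed.

Lemma run_store a b s Q (i : nat) x :
  registers s a = i%:R -> registers s b = x ->
  Q (State (registers s) (update (memory s) i x) (out s)) ->
  run W (Store a b) s 1 Q.
Proof.
move=> aE bE Qs bs; do 2!eexists; split; first exact: (ExecStore aE bE).
- by have := bs.1 a; have := bs.1 b; rewrite aE bE; have := natbits_ratbits i; lia.
- by case: bs => rW mW; split=> //= i'; rewrite /update -bE; case: ifP.
- exact: Qs.
Qed.

Lemma run_write a s Q :
  Q (State (registers s) (memory s) (rcons (out s) (registers s a))) ->
  run W (Write a) s 1 Q.
Proof.
move=> Qs bs; do 2!eexists; split; first exact: (ExecWrite erefl).
- by have := bs.1 a; lia.
- exact: bs.
- exact: Qs.
Qed.

Lemma run_if a b c1 c2 s N Q :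
  (registers s a <= registers s b -> run W c1 s N Q) ->
  (~~ (registers s a <= registers s b) -> run W c2 s N Q) ->
  run W (IfLe a b c1 c2) s N.+1 Q.
Proof.
move=> run1 run2 bs.
have : run W (if registers s a <= registers s b then c1 else c2) s N Q.
  by case: ifPn.
case/(_ bs) => s' [T [e Tle bs' Qs]]; do 2!eexists; split.
- exact: (ExecIfLe erefl erefl e).
- by have := bs.1 a; have := bs.1 b; lia.
- exact: bs'.
- exact: Qs.
Qed.

(** The only test is [<=], so register [b] holds [n - 1], which is -1 for [n = 0]. Each round pays
    one step for its test, and the final failing test pays the last one. *)
Lemma run_for a b body (n N : nat) (Inv : nat -> state -> Prop) s :
  (forall k s1, Inv k s1 -> registers s1 a = k%:R /\ registers s1 b = n%:R - 1) ->
  (forall k s1, (k < n)%N -> Inv k s1 -> run W body s1 N (Inv k.+1)) ->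
  Inv 0%N s -> run W (WhileLe a b body) s (n * N.+1).+1 (Inv n).
Proof.
move=> InvE Inv_step Inv0.
suff loop k r s1 : (k + r = n)%N -> Inv k s1 ->
    run W (WhileLe a b body) s1 (r * N.+1).+1 (Inv n).
  exact: (loop 0%N n).
elim: r k s1 => [|r IHr] k s1 krn Invk bs; have [aE bE] := InvE _ _ Invk.
  have kn : k = n by rewrite -krn addn0.
  exists s1; eexists; split.
  - apply: (ExecWhileStop _ aE bE); rewrite kn -ltNge; lra.
  - by have := bs.1 a; have := bs.1 b; rewrite aE bE; lia.
  - exact: bs.
  - by rewrite -kn.
have kn : (k < n)%N by lia.
have [s2 [T1 [e1 T1le bs2 Inv2]]] := Inv_step k s1 kn Invk bs.
have [s3 [T2 [e2 T2le bs3 Inv3]]] := IHr k.+1 s2 ltac:(lia) Inv2 bs2.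
exists s3; eexists; split.
- apply: (ExecWhileStep aE bE _ e1 e2).
  by rewrite lerBrDr natr1 ler_nat.
- have := bs.1 a; have := bs.1 b; rewrite aE bE; nia.
- exact: bs3.
- exact: Inv3.
Qed.

End Run.

(** * The program *)

Definition seqs : seq cmd -> cmd := foldr Seq Skip.

Definition array (mem : nat -> rat) (b len : nat) (f : nat -> rat) : Prop :=
  forall j, (j < len)%N -> mem (b + j)%N = f j.

Lemma array_update_out mem b len f a x : (a < b)%N || (b + len <= a)%N ->
  array mem b len f -> array (update mem a x) b len f.
Proof.
move=> out_a mem_f j jlen; rewrite /update ifF ?mem_f //; apply/eqP; lia.
Qed.

Section Program.
Variables (n m : nat) (p w c : nat -> rat) (sigma : nat -> nat) (K : nat).
Hypothesis sigma_lt : forall i, (i < n)%N -> (sigma i < n)%N.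
Hypothesis sigmaK : forall i, (i < n)%N -> rank n p (sigma i) = i.
Hypothesis p_fits : forall j, (j < n)%N -> fits K (p j).
Hypothesis w_fits : forall j, (j < n)%N -> fits K (w j).
Hypothesis c_fits : forall l, (l < m)%N -> fits K (c l).

Let wr r := w (sigma (n.-1 - r)%N).
Let ps i := p (sigma i).
Let cnt i := count_at c m wr (n.-1 - i)%N.
(* [A] bounds the bits gained in one step of the recurrences for [profit] and
   [time_at], intermediate results included. *)
Let A := (m * K + 3 * m + K + 6)%N.
(** [n] rounds of [A] bits each, with slack for intermediate values and memory addresses; [W] then
    converts [fits] bounds to bit lengths. *)
Let H := ((n + 2) * A)%N.
Let W := (H.*2 + 3)%N.

Lemma small_fits k x : fits k x -> (k <= H)%N -> (ratbits x <= W)%N.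
Proof. by move=> fx kH; apply: fits_ratbits; apply: fits_le fx. Qed.

Lemma small_nat i : (i <= 6 * n + m + 3)%N -> (ratbits i%:R <= W)%N.
Proof. by move=> h; apply: small_fits (fits_nat i) _; rewrite /H /A; nia. Qed.

Lemma small_pred i : (i <= n + m)%N -> (ratbits (i%:R - 1) <= W)%N.
Proof.
move=> h; apply: small_fits (fits_sub (fits_nat i) (fits_nat 1)) _.
by rewrite /H /A; nia.
Qed.

(** The size does not depend on [V], which only decides which costs are summed. *)
Lemma fits_fill V l : (l <= m)%N -> fits (l * K.+1) (fill c V l).1.
Proof.
elim: l => [|l IHl] lm /=; first exact: (fits_nat 0).
have := IHl (ltnW lm); case: fill => s k /= fs.
have fsc := fits_add fs (c_fits lm).
by case: ifP => _ /=; [apply: fits_le fsc | apply: fits_le fs]; lia.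
Qed.

(** A round adds [K] bits for the weight, [m * K.+1] for the sum of costs, at most [2 * m] for
    multiplying and dividing by counts, and 3 more, which fits in [A]. *)
Lemma fits_profit r : (r <= n)%N -> fits (r * A) (profit c m wr r).
Proof.
elim: r => [|r IHr] rn; first exact: (fits_nat 0).
have fV := fits_add (w_fits (sigma_lt (i := n.-1 - r) ltac:(lia))) (IHr (ltnW rn)).
have /= := fits_fill (wr r + profit c m wr r) (leqnn m).
have := fill_count_le c (wr r + profit c m wr r) m.
case: fill => s k /= km fs.
have := fits_natdiv k (fits_sub (fits_natmul k fV) fs).
by apply: fits_le; rewrite /A; nia.
Qed.

Lemma fits_time i : (i <= n)%N -> fits (i * A) (time_at ps cnt i).
Proof.
elim: i => [|i IHi] lt_i /=; first exact: (fits_nat 0).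
have := fits_natdiv (cnt i)
  (fits_add (p_fits (sigma_lt lt_i)) (fits_natmul (cnt i) (IHi (ltnW lt_i)))).
have : (cnt i <= m)%N by apply: fill_count_le.
by move=> cm; apply: fits_le; rewrite /A; nia.
Qed.

(* Registers 6 to 12 hold the base addresses of the arrays of processing times,
   weights, costs, jobs by position, and (by job) processor counts, start times
   and completion times. *)
Record consts (r : nat -> rat) : Prop := Consts {
  reg0 : r 0%N = n%:R;
  reg1 : r 1%N = m%:R;
  reg2 : r 2%N = 1;
  reg3 : r 3%N = 0;
  reg4 : r 4%N = n%:R - 1;
  reg5 : r 5%N = m%:R - 1;
  reg6 : r 6%N = 2%:R;
  reg7 : r 7%N = (2 + n)%:R;
  reg8 : r 8%N = (2 + n + n)%:R;
  reg9 : r 9%N = (2 + n + n + m)%:R;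
  reg10 : r 10%N = (2 + n + n + m + n)%:R;
  reg11 : r 11%N = (2 + n + n + m + n + n)%:R;
  reg12 : r 12%N = (2 + n + n + m + n + n + n)%:R
}.

Lemma consts_update r d x : (13 <= d)%N -> consts r -> consts (update r d x).
Proof.
move=> d13 [*]; split; rewrite /update; case: eqP => //; lia.
Qed.

(** Registers start at 0, so register 3 already holds the address of [n], and it stays 0 throughout.
    The working arrays begin right after the input. *)
Definition setup_cmd : cmd := seqs [::
  Fetch 0 3; Const 2 1; Fetch 1 2;
  Arith Minus 4 0 2; Arith Minus 5 1 2; Arith Plus 6 2 2;
  Arith Plus 7 6 0; Arith Plus 8 7 0; Arith Plus 9 8 1;
  Arith Plus 10 9 0; Arith Plus 11 10 0; Arith Plus 12 11 0].

Lemma run_setup mem : mem 0%N = n%:R -> mem 1%N = m%:R ->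
  run W setup_cmd (State (fun=> 0) mem [::]) 13
    (fun s => exists2 r, consts r & s = State r mem [::]).
Proof.
move=> mem0 mem1; have snat i := @small_nat i.
apply: run_step; apply: (run_fetch (i := 0) (x := n%:R)) => //=.
apply: run_step; apply: run_const => /=; first by apply: (snat 1%N); lia.
apply: run_step; apply: (run_fetch (i := 1) (x := m%:R)) => //=.
apply: run_step; apply: (run_arith (z := n%:R - 1)) => //=.
  by apply: small_pred; lia.
apply: run_step; apply: (run_arith (z := m%:R - 1)) => //=.
  by apply: small_pred; lia.
apply: run_step; apply: (run_arith (z := 2%:R)) => //=; first by apply: snat; lia.
apply: run_step; apply: (run_arith (z := (2 + n)%:R)) ; first by rewrite /update /= [RHS]natrD.
  by apply: snat; lia.
apply: run_step; apply: (run_arith (z := (2 + n + n)%:R)) ; first by rewrite /update /= [RHS]natrD.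
  by apply: snat; lia.
apply: run_step; apply: (run_arith (z := (2 + n + n + m)%:R)) ; first by rewrite /update /= [RHS]natrD.
  by apply: snat; lia.
apply: run_step; apply: (run_arith (z := (2 + n + n + m + n)%:R)) ; first by rewrite /update /= [RHS]natrD.
  by apply: snat; lia.
apply: run_step; apply: (run_arith (z := (2 + n + n + m + n + n)%:R)) ; first by rewrite /update /= [RHS]natrD.
  by apply: snat; lia.
apply: run_step; apply: (run_arith (z := (2 + n + n + m + n + n + n)%:R)) ; first by rewrite /update /= [RHS]natrD.
  by apply: snat; lia.
by apply: run_skip; eexists; last by [].
Qed.

(** Registers 13 and 15 hold the job and its processing time, 17 and 18 those of the scanned job, 16
    the count. A branch that counts nothing adds register 3, so all branches obey one rule. *)
Definition rank_step : cmd := seqs [::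
  Arith Plus 14 6 17; Fetch 18 14;
  IfLe 13 17
    (IfLe 15 18 (Arith Plus 16 16 3) (Arith Plus 16 16 2))
    (IfLe 18 15 (Arith Plus 16 16 2) (Arith Plus 16 16 3));
  Arith Plus 17 17 2].

Lemma run_rank mem o r k : (k < n)%N -> array mem 2 n p -> consts r ->
  r 13%N = k%:R -> r 15%N = p k -> r 16%N = 0 -> r 17%N = 0 ->
  run W (WhileLe 17 4 rank_step) (State r mem o) (n * 9).+1
    (fun s => exists r', [/\ s = State r' mem o, consts r', r' 13%N = k%:R &
       r' 16%N = (rank n p k)%:R]).
Proof.
move=> kn mem_p Cr r13 r15 r16 r17.
pose Inv k' s := exists r', [/\ s = State r' mem o, consts r', r' 13%N = k%:R,
  r' 15%N = p k &
  r' 16%N = (\sum_(i < k') before p i k)%:R /\ r' 17%N = k'%:R].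
suff : run W (WhileLe 17 4 rank_step) (State r mem o) (n * 9).+1 (Inv n).
  move=> + bs => /(_ bs)[s [T [e T_le bs' [r' [sE Cr' r13' _ [r16' _]]]]]].
  by exists s, T; split=> //; exists r'.
apply: (run_for (Inv := Inv)); last 1 first.
- by exists r; rewrite big_ord0.
- by move=> k' _ [r' [-> Cr' _ _ [_ r17']]] /=; rewrite (reg4 Cr').
move=> k' _ k'n [r' [-> Cr' r13' r15' [r16' r17']]].
have sum_le : (\sum_(i < k'.+1) before p i k <= k'.+1)%N.
  by rewrite -[X in (_ <= X)%N]card_ord -sum1_card leq_sum // => i _; case: before.
apply: run_step; apply: (run_arith (z := (2 + k')%:R)) => /=.
  by rewrite /update /= (reg6 Cr') r17' natrD.
  by apply: small_nat; lia.
apply: run_step; apply: (run_fetch (i := (2 + k')%N) (x := p k')) => //=; first exact: mem_p.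
set r1 := update _ 18 _.
have Cr1 : consts r1 by do !apply: consts_update.
pose x : rat := (\sum_(i < k'.+1) before p i k)%:R.
apply: (run_seq (N1 := 3) (N2 := 2)
  (Q1 := fun s => s = State (update r1 16 x) mem o)) => //.
  have run16 a : r1 a = (before p k' k)%:R ->
      run W (Arith Plus 16 16 a) (State r1 mem o) 1
        (fun s => s = State (update r1 16 x) mem o).
    move=> r1a; apply: (run_arith (z := x)) => //=.
      by rewrite r1a /x big_ord_recr natrD -r16'.
    by apply: small_nat; lia.
  have r1_13 : r1 13%N = k%:R by [].
  have r1_15 : r1 15%N = p k by [].
  have r1_17 : r1 17%N = k'%:R by [].
  have r1_18 : r1 18%N = p k' by [].
  apply: run_if; rewrite /= r1_13 r1_17 ler_nat => kk'; apply: run_if;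
  rewrite /= r1_15 r1_18 => pp; apply: run16; rewrite ?(reg2 Cr1) ?(reg3 Cr1);
  by rewrite /before ?kk' ?(negPf kk') ?pp ?(negPf pp).
move=> _ ->; apply: run_step; apply: (run_arith (z := k'.+1%:R)) => /=.
  by rewrite -[LHS]/(r1 17%N + r1 2%N) (reg2 Cr1) -[r1 17%N]/(r' 17%N) r17' natr1.
  by apply: small_nat; lia.
apply: run_skip; eexists; split; [by [] | by do !apply: consts_update | by [] | by [] | by []].
Qed.

(** Storing each job at the address given by its rank writes down the inverse permutation
    [sigma]. *)
Definition sort_step : cmd := seqs [::
  Arith Plus 14 6 13; Fetch 15 14; Arith Plus 16 3 3; Arith Plus 17 3 3;
  WhileLe 17 4 rank_step;
  Arith Plus 14 9 16; Store 14 13; Arith Plus 13 13 2].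

Definition sort_cmd : cmd := seqs [:: Arith Plus 13 3 3; WhileLe 13 4 sort_step].

Record input (mem : nat -> rat) : Prop := Input {
  input_p : array mem 2 n p;
  input_w : array mem (2 + n) n w;
  input_c : array mem (2 + n + n) m c
}.

Lemma input_update mem a x : (2 + n + n + m <= a)%N ->
  input mem -> input (update mem a x).
Proof. by move=> ha [mp mw mc]; split; apply: array_update_out => //; lia. Qed.

Lemma run_sort mem r o : consts r -> input mem ->
  run W sort_cmd (State r mem o) (n * (n * 9 + 9).+1).+3
    (fun s => exists r' mem', [/\ s = State r' mem' o, consts r', input mem' &
       array mem' (2 + n + n + m) n (fun i => (sigma i)%:R)]).
Proof.
move=> Cr Im; apply: run_step; apply: (run_arith (z := 0)) => /=.
  by rewrite /update /= (reg3 Cr) addr0.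
  by apply: (@small_nat 0).
pose Inv k s := exists r' mem', [/\ s = State r' mem' o, consts r', input mem',
  r' 13%N = k%:R &
  forall j, (j < k)%N -> mem' (2 + n + n + m + rank n p j)%N = j%:R].
apply: (run_seq (Q1 := Inv n) (N1 := (n * (n * 9 + 9).+1).+1) (N2 := 1)); last by lia.
  apply: (run_for (Inv := Inv)).
  - by move=> k _ [r' [mem' [-> Cr' _ ? _]]] /=; rewrite (reg4 Cr').
  - move=> k _ kn [r' [mem' [-> Cr' Im' r13 ranks]]].
    rewrite (_ : n * 9 + 9 = (n * 9 + 5).+4)%N; last by lia.
    apply: run_step; apply: (run_arith (z := (2 + k)%:R)).
      by rewrite /update /= (reg6 Cr') r13 natrD.
      by apply: small_nat; lia.
    apply: run_step; apply: (run_fetch (i := (2 + k)%N) (x := p k)) => //=.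
      exact: (input_p Im').
    apply: run_step; apply: (run_arith (z := 0)).
      by rewrite /update /= (reg3 Cr') addr0.
      by apply: (@small_nat 0).
    apply: run_step; apply: (run_arith (z := 0)).
      by rewrite /update /= (reg3 Cr') addr0.
      by apply: (@small_nat 0).
    rewrite /=; apply: (run_seq (N1 := (n * 9).+1) (N2 := 4)); last by lia.
      by apply: (run_rank (k := k)) => //; do ?[apply: consts_update]; case: Im'.
    move=> _ [r2 [-> Cr2 r2_13 r2_16]].
    have rank_le := rank_lt p kn.
    apply: run_step; apply: (run_arith (z := (2 + n + n + m + rank n p k)%:R)).
      by rewrite /update /= (reg9 Cr2) r2_16 [RHS]natrD.
      by apply: small_nat; lia.
    apply: run_step; apply: (run_store (i := (2 + n + n + m + rank n p k)%N) (x := k%:R)) => //=.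
    apply: run_step; apply: (run_arith (z := k.+1%:R)).
      by rewrite /update /= (reg2 Cr2) r2_13 natr1.
      by apply: small_nat; lia.
    apply: run_skip; do 2!eexists; split; first by [].
    + by do !apply: consts_update.
    + by apply: input_update Im'; lia.
    + by [].
    move=> j jk; rewrite [LHS]/update; case: eqP => [/eqP|ne].
      rewrite eqn_add2l => /eqP/(rank_inj (leq_trans jk kn) kn) ->.
      by [].
    apply: ranks; rewrite ltn_neqAle -ltnS jk andbT.
    by apply: contra_not_neq ne => ->.
  - by exists (update r 13 0), mem; split=> //; apply: consts_update.
move=> _ [r' [mem' [-> Cr' Im' _ ranks]]]; apply: run_skip.
exists r', mem'; split=> // i lt_i.
by rewrite -[in LHS](sigmaK lt_i) ranks // sigma_lt.
Qed.
Lemma sigma_rank j : (j < n)%N -> sigma (rank n p j) = j.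
Proof.
by move=> jn; apply: (@rank_inj _ n p); rewrite ?sigmaK ?sigma_lt ?rank_lt.
Qed.

Lemma sigma_inj i i' : (i < n)%N -> (i' < n)%N -> sigma i = sigma i' -> i = i'.
Proof. by move=> lt_i lt_i' /(congr1 (rank n p)); rewrite !sigmaK. Qed.

(** Registers 16, 17 and 18 hold [V] and the pair computed by [fill]; 20 is the processor, 21 its
    cost and 22 the candidate. *)
Definition fill_step : cmd := seqs [::
  Arith Plus 14 8 20; Fetch 21 14; Arith Plus 22 16 17; Arith Plus 23 18 2;
  Arith Divide 22 22 23;
  IfLe 21 22 (Seq (Arith Plus 17 17 21) (Arith Plus 18 18 2))
    (Seq (Arith Plus 17 17 3) (Arith Plus 18 18 3));
  Arith Plus 20 20 2].

Lemma run_fill mem o r k (V := wr k + profit c m wr k) : (k < n)%N ->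
  array mem (2 + n + n) m c -> consts r ->
  r 16%N = V -> r 17%N = 0 -> r 18%N = 0 -> r 20%N = 0 ->
  run W (WhileLe 20 5 fill_step) (State r mem o) (m * 11).+1
    (fun s => exists r', [/\ s = State r' mem o, consts r',
       [/\ r' 13%N = r 13%N, r' 15%N = r 15%N & r' 16%N = V],
       r' 17%N = (fill c V m).1 & r' 18%N = (fill c V m).2%:R]).
Proof.
move=> kn mem_c Cr r16 r17 r18 r20.
pose Inv l s := exists r', [/\ s = State r' mem o, consts r',
  [/\ r' 13%N = r 13%N, r' 15%N = r 15%N & r' 16%N = V],
  r' 17%N = (fill c V l).1 & r' 18%N = (fill c V l).2%:R /\ r' 20%N = l%:R].
suff : run W (WhileLe 20 5 fill_step) (State r mem o) (m * 11).+1 (Inv m).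
  move=> + bs => /(_ bs)[s [T [e T_le bs' [r' [sE Cr' kept r'17 [r'18 _]]]]]].
  by exists s, T; split=> //; exists r'.
apply: (run_for (Inv := Inv)); last 1 first.
- by exists r.
- by move=> l _ [r' [-> Cr' _ _ [_ r'20]]] /=; rewrite (reg5 Cr').
move=> l _ lm [r' [-> Cr' [r'13 r'15 r'16] r'17 [r'18 r'20]]].
have fV : fits (K + k * A).+1 V.
  by apply: fits_add (fits_profit (ltnW kn)); apply/w_fits/sigma_lt; lia.
have km : ((fill c V l).2 <= m)%N := leq_trans (fill_count_le c V l) (ltnW lm).
have fVs := fits_add fV (fits_fill V (ltnW lm)).
have KA : (((K + k * A).+1 + l * K.+1).+1 + m.+1 <= H)%N.
  by rewrite /H /A; nia.
apply: run_step; apply: (run_arith (z := (2 + n + n + l)%:R)).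
  by rewrite /update /= (reg8 Cr') r'20 [RHS]natrD.
  by apply: small_nat; lia.
apply: run_step; apply: (run_fetch (i := (2 + n + n + l)%N) (x := c l)) => //=.
  exact: mem_c.
apply: run_step; apply: (run_arith (z := V + (fill c V l).1)).
  by rewrite /update /= r'16 r'17.
  by apply: small_fits fVs _; lia.
apply: run_step; apply: (run_arith (z := (fill c V l).2.+1%:R)).
  by rewrite /update /= r'18 (reg2 Cr') natr1.
  by apply: small_nat; lia.
apply: run_step; apply: (run_arith (z := (V + (fill c V l).1) / (fill c V l).2.+1%:R)).
  by rewrite /update /=.
  by apply: small_fits (fits_natdiv _ fVs) _; lia.
rewrite /=; set r1 := update _ 22 _.
have Cr1 : consts r1 by do !apply: consts_update.
pose s1 := (fill c V l.+1).1; pose k1 := (fill c V l.+1).2.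
apply: (run_seq (N1 := 3) (N2 := 2)
  (Q1 := fun s => s = State (update (update r1 17 s1) 18 k1%:R) mem o)) => //.
  have s1W : (ratbits s1 <= W)%N.
    by apply: small_fits (fits_fill V lm) _; rewrite /H /A; nia.
  have k1W : (ratbits k1%:R <= W)%N.
    by apply: small_nat; have := fill_count_le c V l.+1; lia.
  have add_both a b : b != 17%N -> r1 a = s1 - (fill c V l).1 ->
      r1 b = k1%:R - (fill c V l).2%:R ->
      run W (Seq (Arith Plus 17 17 a) (Arith Plus 18 18 b)) (State r1 mem o) 2
        (fun s => s = State (update (update r1 17 s1) 18 k1%:R) mem o).
    move=> b17 r1a r1b; apply: run_step; apply: (run_arith (z := s1)) => //.
      by rewrite /= -[r1 17%N]/(r' 17%N) r'17 r1a addrC subrK.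
    apply: (run_arith (z := k1%:R)) => //=.
    have -> : update r1 17 s1 b = r1 b by rewrite /update (negPf b17).
    by rewrite -[update _ _ _ _]/(r' 18%N) r'18 r1b addrC subrK.
  have fillS : (s1, k1) =
      if c l <= (V + (fill c V l).1) / (fill c V l).2.+1%:R
      then ((fill c V l).1 + c l, (fill c V l).2.+1) else fill c V l.
    by rewrite /s1 /k1 /=; case: fill => s' k' /=; case: ifP.
  have r1_21 : r1 21%N = c l by [].
  have r1_22 : r1 22%N = (V + (fill c V l).1) / (fill c V l).2.+1%:R by [].
  apply: run_if => /=; rewrite r1_21 r1_22 => test; apply: add_both => //;
    move: fillS; rewrite ?test ?(negPf test).
  - by case=> -> _; rewrite addrC addKr.
  - by case=> _ ->; rewrite (reg2 Cr1) -natr1 addrC addKr.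
  - by case: fill => s' k' [-> _] /=; rewrite (reg3 Cr1) subrr.
  - by case: fill => s' k' [_ ->] /=; rewrite (reg3 Cr1) subrr.
move=> _ ->; apply: run_step; apply: (run_arith (z := l.+1%:R)).
  by rewrite /update /= (reg2 Cr1) -[r1 20%N]/(r' 20%N) r'20 natr1.
  by apply: small_nat; lia.
apply: run_skip; eexists; split; first by [].
- by do !apply: consts_update.
- by split.
- by [].
- by split.
Qed.

(** Round [r] treats position [n - 1 - r], with the running profit in register 19. Counts are stored
    by job, since the output lists jobs in input order. *)
Definition profit_step : cmd := seqs [::
  Arith Minus 14 4 13; Arith Plus 14 9 14; Fetch 15 14;
  Arith Plus 14 7 15; Fetch 16 14; Arith Plus 16 16 19;
  Arith Plus 17 3 3; Arith Plus 18 3 3; Arith Plus 20 3 3;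
  WhileLe 20 5 fill_step;
  Arith Times 22 18 16; Arith Minus 22 22 17; Arith Plus 23 18 2;
  Arith Divide 19 22 23;
  Arith Plus 14 10 15; Store 14 18; Arith Plus 13 13 2].

Definition profit_cmd : cmd := seqs [::
  Arith Plus 13 3 3; Arith Plus 19 3 3; WhileLe 13 4 profit_step].

Lemma run_profit mem r o : consts r -> input mem ->
  array mem (2 + n + n + m) n (fun i => (sigma i)%:R) ->
  run W profit_cmd (State r mem o) (n * (m * 11 + 18).+1).+4
    (fun s => exists r' mem', [/\ s = State r' mem' o, consts r', input mem',
       array mem' (2 + n + n + m) n (fun i => (sigma i)%:R) &
       array mem' (2 + n + n + m + n) n (fun j => (cnt (rank n p j))%:R)]).
Proof.
move=> Cr Im mem_sigma; apply: run_step; apply: (run_arith (z := 0)).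
  by rewrite /update /= (reg3 Cr) addr0.
  by apply: (@small_nat 0).
apply: run_step; apply: (run_arith (z := 0)).
  by rewrite /update /= (reg3 Cr) addr0.
  by apply: (@small_nat 0).
pose Inv k s := exists r' mem', [/\ s = State r' mem' o, consts r', input mem',
  array mem' (2 + n + n + m) n (fun i => (sigma i)%:R) &
  [/\ r' 13%N = k%:R, r' 19%N = profit c m wr k &
  forall i, (i < k)%N ->
    mem' (2 + n + n + m + n + sigma (n.-1 - i))%N = (count_at c m wr i)%:R]].
apply: (run_seq (Q1 := Inv n) (N1 := (n * (m * 11 + 18).+1).+1) (N2 := 1)); last by lia.
  apply: (run_for (Inv := Inv)).
  - by move=> k _ [r' [mem' [-> Cr' _ _ [? _ _]]]] /=; rewrite (reg4 Cr').
  - move=> k _ kn [r' [mem' [-> Cr' Im' mem'_sigma [r13 r19 counts]]]].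
    have lt_pos : (n.-1 - k < n)%N by lia.
    have lt_job := sigma_lt lt_pos.
    set j := sigma (n.-1 - k) in lt_job *.
    have fV := fits_add (w_fits lt_job) (fits_profit (ltnW kn)).
    have zero d s N c' Q : r' 3%N = registers s 3%N ->
        run W c' (State (update (registers s) d 0) (memory s) (out s)) N Q ->
        run W (Seq (Arith Plus d 3 3) c') s N.+1 Q.
      move=> r3 run_c'; apply: run_step; apply: (run_arith (z := 0)) => //.
        by rewrite /= -r3 (reg3 Cr') addr0.
      by apply: (@small_nat 0).
    rewrite (_ : m * 11 + 18 = (m * 11 + 9).+4.+4.+1)%N; last by lia.
    apply: run_step; apply: (run_arith (z := (n.-1 - k)%:R)).
      rewrite /update /= (reg4 Cr') r13 -subn1 !natrB //; lia.
      by apply: small_nat; lia.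
    apply: run_step; apply: (run_arith (z := (2 + n + n + m + (n.-1 - k))%:R)).
      by rewrite /update /= (reg9 Cr') [RHS]natrD.
      by apply: small_nat; lia.
    apply: run_step;
      apply: (run_fetch (i := (2 + n + n + m + (n.-1 - k))%N) (x := j%:R)) => //=.
      exact: mem'_sigma.
    apply: run_step; apply: (run_arith (z := (2 + n + j)%:R)).
      by rewrite /update /= (reg7 Cr') [RHS]natrD.
      by apply: small_nat; lia.
    apply: run_step; apply: (run_fetch (i := (2 + n + j)%N) (x := w j)) => //=.
      exact: (input_w Im').
    apply: run_step; apply: (run_arith (z := w j + profit c m wr k)).
      by rewrite /update /= r19.
      by apply: small_fits fV _; rewrite /H /A; nia.
    do 3![apply: (zero) => //=].
    apply: (run_seq (N1 := (m * 11).+1) (N2 := 8)); last by lia.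
      by apply: (run_fill (k := k)) => //; do ?[apply: consts_update]; case: Im'.
    rewrite -/(wr k); set V := wr k + _; move=> _ [r2 [-> Cr2 [r2_13 r2_15 r2_16] r2_17 r2_18]].
    have r2_j : r2 15%N = j%:R by rewrite r2_15.
    have r2_k : r2 13%N = k%:R by rewrite r2_13.
    have count_le := fill_count_le c V m.
    have fs := fits_fill V (leqnn m).
    have fkV := fits_natmul (fill c V m).2 fV.
    have fnum := fits_sub fkV fs.
    apply: run_step; apply: (run_arith (z := (fill c V m).2%:R * V)).
      by rewrite /update /= r2_18 r2_16.
      by apply: small_fits fkV _; rewrite /H /A; nia.
    apply: run_step; apply: (run_arith (z := (fill c V m).2%:R * V - (fill c V m).1)).
      by rewrite /update /= r2_17.
      by apply: small_fits fnum _; rewrite /H /A; nia.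
    apply: run_step; apply: (run_arith (z := (fill c V m).2.+1%:R)).
      by rewrite /update /= r2_18 (reg2 Cr2) natr1.
      by apply: small_nat; lia.
    apply: run_step; apply: (run_arith (z := profit c m wr k.+1)).
      by rewrite /update /= -/V; case: fill.
      by apply: small_fits (fits_profit kn) _; rewrite /H; nia.
    apply: run_step; apply: (run_arith (z := (2 + n + n + m + n + j)%:R)).
      by rewrite /update /= (reg10 Cr2) r2_j [RHS]natrD.
      by apply: small_nat; lia.
    apply: run_step; apply: (run_store (i := (2 + n + n + m + n + j)%N)
      (x := (fill c V m).2%:R)) => //=.
    apply: run_step; apply: (run_arith (z := k.+1%:R)).
      by rewrite /update /= (reg2 Cr2) r2_k natr1.
      by apply: small_nat; lia.
    apply: run_skip; do 2!eexists; split; first by [].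
    + by do !apply: consts_update.
    + by apply: input_update Im'; lia.
    + by apply: array_update_out mem'_sigma; lia.
    split=> // i ik; rewrite [LHS]/update eqn_add2l; case: eqP => [ij|ne].
      have -> : i = k by have := sigma_inj _ _ ij; lia.
      by [].
    apply: counts; rewrite ltn_neqAle -ltnS ik andbT.
    by apply: contra_not_neq ne => ->.
  - exists (update (update r 13 0) 19 0), mem; split=> //.
    by do !apply: consts_update.
move=> _ [r' [mem' [-> Cr' Im' mem'_sigma [_ _ counts]]]]; apply: run_skip.
exists r', mem'; split=> // j jn; have lt_rank := rank_lt p jn.
have := counts (n.-1 - rank n p j)%N ltac:(lia).
by have -> : (n.-1 - (n.-1 - rank n p j))%N = rank n p j by [lia]; rewrite sigma_rank.
Qed.

(** Register 19 carries the current time: it is stored as the start of the job before the update and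
    as its completion after. *)
Definition time_step : cmd := seqs [::
  Arith Plus 14 9 13; Fetch 15 14; Arith Plus 14 6 15; Fetch 16 14;
  Arith Plus 14 10 15; Fetch 18 14; Arith Plus 14 11 15; Store 14 19;
  Arith Times 22 18 19; Arith Plus 22 16 22; Arith Plus 23 18 2;
  Arith Divide 19 22 23;
  Arith Plus 14 12 15; Store 14 19; Arith Plus 13 13 2].

Definition time_cmd : cmd := seqs [::
  Arith Plus 13 3 3; Arith Plus 19 3 3; WhileLe 13 4 time_step].

Lemma run_time mem r o : consts r -> input mem ->
  array mem (2 + n + n + m) n (fun i => (sigma i)%:R) ->
  array mem (2 + n + n + m + n) n (fun j => (cnt (rank n p j))%:R) ->
  run W time_cmd (State r mem o) (n * 17).+4
    (fun s => exists r' mem', [/\ s = State r' mem' o, consts r',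
       array mem' (2 + n + n + m + n) n (fun j => (cnt (rank n p j))%:R),
       array mem' (2 + n + n + m + n + n) n
         (fun j => time_at ps cnt (rank n p j)) &
       array mem' (2 + n + n + m + n + n + n) n
         (fun j => time_at ps cnt (rank n p j).+1)]).
Proof.
move=> Cr Im mem_sigma mem_cnt; apply: run_step; apply: (run_arith (z := 0)).
  by rewrite /update /= (reg3 Cr) addr0.
  by apply: (@small_nat 0).
apply: run_step; apply: (run_arith (z := 0)).
  by rewrite /update /= (reg3 Cr) addr0.
  by apply: (@small_nat 0).
pose Inv k s := exists r' mem', [/\ s = State r' mem' o, consts r', input mem',
  array mem' (2 + n + n + m) n (fun i => (sigma i)%:R) /\
  array mem' (2 + n + n + m + n) n (fun j => (cnt (rank n p j))%:R) &
  [/\ r' 13%N = k%:R, r' 19%N = time_at ps cnt k &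
  forall i, (i < k)%N ->
    mem' (2 + n + n + m + n + n + sigma i)%N = time_at ps cnt i /\
    mem' (2 + n + n + m + n + n + n + sigma i)%N = time_at ps cnt i.+1]].
apply: (run_seq (Q1 := Inv n) (N1 := (n * 17).+1) (N2 := 1)); last by lia.
  apply: (run_for (Inv := Inv)).
  - by move=> k _ [r' [mem' [-> Cr' _ _ [? _ _]]]] /=; rewrite (reg4 Cr').
  - move=> k _ kn [r' [mem' [-> Cr' Im' [mem'_sigma mem'_cnt] [r13 r19 times]]]].
    have lt_job := sigma_lt kn; set j := sigma k in lt_job *.
    have cnt_le : (cnt k <= m)%N by apply: fill_count_le.
    have fkt := fits_natmul (cnt k) (fits_time (ltnW kn)).
    have fnum := fits_add (p_fits lt_job) fkt.
    apply: run_step; apply: (run_arith (z := (2 + n + n + m + k)%:R)).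
      by rewrite /update /= (reg9 Cr') r13 [RHS]natrD.
      by apply: small_nat; lia.
    apply: run_step;
      apply: (run_fetch (i := (2 + n + n + m + k)%N) (x := j%:R)) => //=.
      exact: mem'_sigma.
    apply: run_step; apply: (run_arith (z := (2 + j)%:R)).
      by rewrite /update /= (reg6 Cr') [RHS]natrD.
      by apply: small_nat; lia.
    apply: run_step; apply: (run_fetch (i := (2 + j)%N) (x := p j)) => //=.
      exact: (input_p Im').
    apply: run_step; apply: (run_arith (z := (2 + n + n + m + n + j)%:R)).
      by rewrite /update /= (reg10 Cr') [RHS]natrD.
      by apply: small_nat; lia.
    apply: run_step;
      apply: (run_fetch (i := (2 + n + n + m + n + j)%N) (x := (cnt k)%:R)) => //=.
      by rewrite mem'_cnt // sigmaK.
    apply: run_step; apply: (run_arith (z := (2 + n + n + m + n + n + j)%:R)).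
      by rewrite /update /= (reg11 Cr') [RHS]natrD.
      by apply: small_nat; lia.
    apply: run_step; apply: (run_store (i := (2 + n + n + m + n + n + j)%N)
      (x := time_at ps cnt k)) => //=.
    apply: run_step; apply: (run_arith (z := (cnt k)%:R * time_at ps cnt k)).
      by rewrite /update /= r19.
      by apply: small_fits fkt _; rewrite /H /A; nia.
    apply: run_step; apply: (run_arith (z := p j + (cnt k)%:R * time_at ps cnt k)).
      by rewrite /update /=.
      by apply: small_fits fnum _; rewrite /H /A; nia.
    apply: run_step; apply: (run_arith (z := (cnt k).+1%:R)).
      by rewrite /update /= (reg2 Cr') natr1.
      by apply: small_nat; lia.
    apply: run_step; apply: (run_arith (z := time_at ps cnt k.+1)).
      by rewrite /update /=.
      by apply: small_fits (fits_time kn) _; rewrite /H; nia.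
    apply: run_step; apply: (run_arith (z := (2 + n + n + m + n + n + n + j)%:R)).
      by rewrite /update /= (reg12 Cr') [RHS]natrD.
      by apply: small_nat; lia.
    apply: run_step; apply: (run_store (i := (2 + n + n + m + n + n + n + j)%N)
      (x := time_at ps cnt k.+1)) => //=.
    apply: run_step; apply: (run_arith (z := k.+1%:R)).
      by rewrite /update /= (reg2 Cr') r13 natr1.
      by apply: small_nat; lia.
    apply: run_skip; do 2!eexists; split; first by [].
    + by do !apply: consts_update.
    + by do 2![apply: input_update; first by lia].
    + split; do 2![apply: array_update_out; first by lia]; done.
    split=> // i ik; rewrite [memory _]/=; have [->|ne] := eqVneq i k.
      split; last by rewrite /update eqxx.
      by rewrite /update eqxx ifF //; apply/eqP; lia.
    have lt_ik : (i < k)%N by rewrite ltn_neqAle ne -ltnS.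
    have lt_in := ltn_trans lt_ik kn; have := sigma_lt lt_in.
    have ne_job : sigma i != j by apply: contra_neq ne => /(sigma_inj lt_in kn).
    have [t1 t2] := times i lt_ik; move=> lt_sigma.
    by split; rewrite /update !ifF //; apply/eqP; move/eqP: ne_job; lia.
  - exists (update (update r 13 0) 19 0), mem; split=> //.
    by do !apply: consts_update.
move=> _ [r' [mem' [-> Cr' Im' [mem'_sigma mem'_cnt] [_ _ times]]]]; apply: run_skip.
exists r', mem'; split=> // j jn; have [t1 t2] := times _ (rank_lt p jn).
  by rewrite -t1 sigma_rank.
by rewrite -t2 sigma_rank.
Qed.

(** A list of pieces is encoded with its length first: register 3 writes the empty list, register 2
    announces one interval. The strict guards are tested through their negations. *)
Definition output_pieces_step : cmd := seqs [::
  IfLe 18 20 (Write 3)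
    (IfLe 16 15 (Write 3) (Seq (Write 2) (Seq (Write 15) (Write 16))));
  Arith Plus 20 20 2].

Definition output_step : cmd := seqs [::
  Arith Plus 14 12 13; Fetch 16 14; Write 16; Arith Plus 14 11 13; Fetch 15 14;
  Arith Plus 14 10 13; Fetch 18 14; Arith Plus 20 3 3;
  WhileLe 20 5 output_pieces_step; Arith Plus 13 13 2].

Definition output_cmd : cmd := seqs [::
  Arith Plus 13 3 3; WhileLe 13 4 output_step].

Definition output_piece (j l : nat) : seq rat :=
  let i := rank n p j in
  if (l < cnt i)%N && (time_at ps cnt i < time_at ps cnt i.+1)
  then [:: 1; time_at ps cnt i; time_at ps cnt i.+1] else [:: 0].

Definition output_job (j : nat) : seq rat :=
  time_at ps cnt (rank n p j).+1 ::
  flatten [seq output_piece j l | l <- iota 0 m].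

Lemma run_output_pieces mem o r j (i := rank n p j) : consts r ->
  r 15%N = time_at ps cnt i -> r 16%N = time_at ps cnt i.+1 ->
  r 18%N = (cnt i)%:R -> r 20%N = 0 ->
  run W (WhileLe 20 5 output_pieces_step) (State r mem o) (m * 8).+1
    (fun s => exists2 r', consts r' /\ r' 13%N = r 13%N &
       s = State r' mem (o ++ flatten [seq output_piece j l | l <- iota 0 m])).
Proof.
move=> Cr r15 r16 r18 r20.
pose Inv l s := exists r', [/\
  s = State r' mem (o ++ flatten [seq output_piece j l | l <- iota 0 l]),
  consts r', r' 20%N = l%:R & [/\ r' 13%N = r 13%N, r' 15%N = r 15%N,
  r' 16%N = r 16%N & r' 18%N = r 18%N]].
suff : run W (WhileLe 20 5 output_pieces_step) (State r mem o) (m * 8).+1 (Inv m).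
  move=> + bs => /(_ bs)[s [T [e T_le bs' [r' [sE Cr' _ [r'13 _ _ _]]]]]].
  by exists s, T; split=> //; exists r'.
apply: (run_for (Inv := Inv)); last 1 first.
- by exists r; rewrite cats0.
- by move=> l _ [r' [-> Cr' r'20 _]] /=; rewrite (reg5 Cr').
move=> l _ lm [r' [-> Cr' r'20 [r'13 r'15 r'16 r'18]]].
set ol := o ++ _.
apply: (run_seq (N1 := 5) (N2 := 2)
  (Q1 := fun s => s = State r' mem (ol ++ output_piece j l))) => //.
  have write_zero N : output_piece j l = [:: 0] ->
      run W (Write 3) (State r' mem ol) N.+1
        (fun s => s = State r' mem (ol ++ output_piece j l)).
    move=> ->; have : run W (Write 3) (State r' mem ol) 1
        (fun s => s = State r' mem (ol ++ [:: 0])).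
      by apply: run_write; rewrite /= (reg3 Cr') cats1.
    move=> + bs => /(_ bs)[s [T [e T_le bs' sE]]]; exists s, T; split=> //.
    by apply: leq_trans T_le _; rewrite leq_mul2r orbT.
  apply: run_if => /=; rewrite r'18 r18 r'20 ler_nat => le_l.
    by apply: write_zero; rewrite /output_piece ltnNge -/i le_l.
  apply: run_if => /=; rewrite r'15 r15 r'16 r16 => le_t.
    by apply: write_zero; rewrite /output_piece [in X in _ && X]ltNge -/i le_t andbF.
  rewrite /output_piece -/i ltnNge le_l ltNge le_t /=.
  apply: run_step; apply: run_write; apply: run_step; apply: run_write.
  apply: run_write; rewrite /= (reg2 Cr') r'15 r'16 r15 r16.
  by rewrite -!cats1 -!catA.
move=> _ ->; apply: run_step; apply: (run_arith (z := l.+1%:R)).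
  by rewrite /= (reg2 Cr') r'20 natr1.
  by apply: small_nat; lia.
apply: run_skip; exists (update r' 20 l.+1%:R); split.
- by congr (State _ _ _); rewrite -[l.+1]addn1 iotaD map_cat flatten_cat /= cats0 catA.
- exact: consts_update.
- by [].
- by split.
Qed.

Lemma run_output mem r : consts r ->
  array mem (2 + n + n + m + n) n (fun j => (cnt (rank n p j))%:R) ->
  array mem (2 + n + n + m + n + n) n (fun j => time_at ps cnt (rank n p j)) ->
  array mem (2 + n + n + m + n + n + n) n
    (fun j => time_at ps cnt (rank n p j).+1) ->
  run W output_cmd (State r mem [::]) (n * (m * 8 + 11).+1).+3
    (fun s => out s = flatten [seq output_job j | j <- iota 0 n]).
Proof.
move=> Cr mem_cnt mem_start mem_end.
apply: run_step; apply: (run_arith (z := 0)).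
  by rewrite /update /= (reg3 Cr) addr0.
  by apply: (@small_nat 0).
pose Inv k s := exists r', [/\
  s = State r' mem (flatten [seq output_job j | j <- iota 0 k]), consts r' &
  r' 13%N = k%:R].
apply: (run_seq (Q1 := Inv n) (N1 := (n * (m * 8 + 11).+1).+1) (N2 := 1)); last by lia.
  apply: (run_for (Inv := Inv)).
  - by move=> k _ [r' [-> Cr' ?]] /=; rewrite (reg4 Cr').
  - move=> k _ kn [r' [-> Cr' r13]]; set o := flatten _.
    rewrite (_ : m * 8 + 11 = (m * 8 + 3).+4.+4)%N; last by lia.
    apply: run_step; apply: (run_arith (z := (2 + n + n + m + n + n + n + k)%:R)).
      by rewrite /update /= (reg12 Cr') r13 [RHS]natrD.
      by apply: small_nat; lia.
    apply: run_step; apply: (run_fetch (i := (2 + n + n + m + n + n + n + k)%N)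
      (x := time_at ps cnt (rank n p k).+1)) => //=; first exact: mem_end.
    apply: run_step; apply: run_write => /=.
    apply: run_step; apply: (run_arith (z := (2 + n + n + m + n + n + k)%:R)).
      by rewrite /update /= (reg11 Cr') r13 [RHS]natrD.
      by apply: small_nat; lia.
    apply: run_step; apply: (run_fetch (i := (2 + n + n + m + n + n + k)%N)
      (x := time_at ps cnt (rank n p k))) => //=; first exact: mem_start.
    apply: run_step; apply: (run_arith (z := (2 + n + n + m + n + k)%:R)).
      by rewrite /update /= (reg10 Cr') r13 [RHS]natrD.
      by apply: small_nat; lia.
    apply: run_step; apply: (run_fetch (i := (2 + n + n + m + n + k)%N)
      (x := (cnt (rank n p k))%:R)) => //=; first exact: mem_cnt.
    apply: run_step; apply: (run_arith (z := 0)).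
      by rewrite /update /= (reg3 Cr') addr0.
      by apply: (@small_nat 0).
    rewrite /=; apply: (run_seq (N1 := (m * 8).+1) (N2 := 2)); last by lia.
      by apply: (run_output_pieces (j := k)) => //; do !apply: consts_update.
    move=> _ [r2 [Cr2 r2_13] ->].
    have r2_k : r2 13%N = k%:R by rewrite r2_13.
    apply: run_step; apply: (run_arith (z := k.+1%:R)).
      by rewrite /update /= (reg2 Cr2) r2_k natr1.
      by apply: small_nat; lia.
    apply: run_skip; exists (update r2 13 k.+1%:R); split; last by [].
    + congr (State _ _ _).
      by rewrite -[k.+1]addn1 iotaD map_cat flatten_cat /= cats0 cat_rcons.
    + exact: consts_update.
  - by exists (update r 13 0); split=> //; apply: consts_update.
by move=> _ [r' [-> _ _]]; apply: run_skip.
Qed.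

Definition schedule_cmd : cmd := seqs [::
  setup_cmd; sort_cmd; profit_cmd; time_cmd; output_cmd].

Lemma run_schedule mem : mem 0%N = n%:R -> mem 1%N = m%:R -> input mem ->
  run W schedule_cmd (State (fun=> 0) mem [::]) (100 * (n + m + 1) ^ 2)
    (fun s => out s = flatten [seq output_job j | j <- iota 0 n]).
Proof.
move=> mem0 mem1 Im.
pose N4 := ((n * (m * 8 + 11).+1).+3 + 1)%N.
pose N3 := ((n * 17).+4 + N4)%N.
pose N2 := ((n * (m * 11 + 18).+1).+4 + N3)%N.
pose N1 := ((n * (n * 9 + 9).+1).+3 + N2)%N.
(* The leading terms are [9 * n ^ 2] for sorting and [19 * n * m] for filling and output; 100 is
   generous. *)
have le_N : (13 + N1 <= 100 * (n + m + 1) ^ 2)%N.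
  by rewrite /N1 /N2 /N3 /N4 -mulnn; nia.
apply: (run_seq (run_setup mem0 mem1) _ le_N).
move=> _ [r Cr ->] /=.
apply: (run_seq (N2 := N2) (run_sort Cr Im)); last exact: leqnn.
move=> _ [r1 [mem1' [-> Cr1 Im1 sigma1]]].
apply: (run_seq (N2 := N3) (run_profit Cr1 Im1 sigma1)); last exact: leqnn.
move=> _ [r2 [mem2 [-> Cr2 Im2 sigma2 cnt2]]].
apply: (run_seq (N2 := N4) (run_time Cr2 Im2 sigma2 cnt2)); last exact: leqnn.
move=> _ [r3 [mem3 [-> Cr3 cnt3 start3 end3]]].
apply: (run_seq (N2 := 1) (run_output Cr3 cnt3 start3 end3)); last exact: leqnn.
by move=> s outE; apply: run_skip.
Qed.

End Program.

(** * Encoded instances and the polynomial bound *)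

Lemma leq_input_size (s : seq rat) q : q \in s -> (ratbits q <= input_size s)%N.
Proof. by move=> qs; rewrite /input_size (big_rem q) //= leq_addr. Qed.

Lemma size_input_size (s : seq rat) : (size s <= input_size s)%N.
Proof. by rewrite -sum1_size; apply: leq_sum => q _; apply: ratbits_gt0. Qed.

Lemma map_enum_ord (T : Type) (n : nat) (f : nat -> T) :
  [seq f (i : 'I_n) | i <- enum 'I_n] = [seq f i | i <- iota 0 n].
Proof. by rewrite -val_enum_ord -map_comp. Qed.

Section EncodedInstance.
Variable I : instance rat.

Lemma size_encode_instance :
  size (encode_instance I) = (2 + njobs I + njobs I + nprocs I)%N.
Proof. by rewrite /encode_instance !size_cat !size_map -!enumT !size_enum_ord /=; lia. Qed.

Lemma nth_ptime j : (j < njobs I)%N ->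
  nth 0 (encode_instance I) (2 + j) = table (ptime I) j.
Proof. by move=> lt_j; rewrite /= nth_cat size_map size_enum_ord lt_j. Qed.

Lemma nth_weight j : (j < njobs I)%N ->
  nth 0 (encode_instance I) (2 + njobs I + j) = table (weight I) j.
Proof.
move=> lt_j; rewrite /= nth_cat size_map size_enum_ord ifN ?addKn; last by lia.
by rewrite nth_cat size_map size_enum_ord lt_j.
Qed.

Lemma nth_cost l : (l < nprocs I)%N ->
  nth 0 (encode_instance I) (2 + njobs I + njobs I + l) = table (cost I) l.
Proof.
move=> lt_l; rewrite /= nth_cat size_map size_enum_ord ifN; last by lia.
rewrite (_ : _ - njobs I = njobs I + l)%N; last by lia.
rewrite nth_cat size_map size_enum_ord ifN ?addKn //; lia.
Qed.

End EncodedInstance.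

Lemma schedule_polytime :
  polytime_computable encode_instance
    (fun (I : instance rat) (S : schedule_for I) => encode_schedule S)
    (fun I : instance rat => valid I /\ antithetical I)
    (fun (I : instance rat) (S : schedule_for I) =>
       forall R : realFieldType,
         optimal_synchronized (I := map_instance (ratr : rat -> R) I)
           (map_schedule (ratr : rat -> R) S)).
Proof.
(* The number of steps is quadratic and the bit length [W] cubic in the input size; each of the two
   constant factors, 100 and 45, is absorbed by one more factor [K + 100]. *)
exists schedule_cmd, (('X + 100%:P) ^+ 7) => I [I_valid I_anti].
set n := njobs I; set m := nprocs I; set K := input_size (encode_instance I).
pose p := table (ptime I); pose w := table (weight I); pose c := table (cost I).
pose rho := rank_perm n p.
pose sigma i := if insub i is Some o then nat_of_ord ((rho^-1)%g (o : 'I_n)) else 0%N.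
have rhoE (j : 'I_n) : rho j = rank n p j :> nat := rank_permE p j.
have sigmaE i (lt_i : (i < n)%N) : sigma i = (rho^-1)%g (Ordinal lt_i).
  by rewrite /sigma insubT.
have sigma_lt i : (i < n)%N -> (sigma i < n)%N by move=> lt_i; rewrite sigmaE.
have sigmaK i : (i < n)%N -> rank n p (sigma i) = i.
  by move=> lt_i; rewrite sigmaE -rhoE permKV.
have sigma_rho (j : 'I_n) : sigma (rho j) = j.
  by rewrite /sigma valK permK.
pose wr r := w (sigma (n.-1 - r)%N); pose ps i := p (sigma i).
pose cnt i := count_at c m wr (n.-1 - i)%N.
have [|j|j|l|i lt_i|u [B gs]] := @fill_greedy_schedule _ I rho ps wr c cnt I_valid.
- move=> j j'; rewrite !rhoE => le_jj'.
  by rewrite -!(tableE (ptime I)); apply: rank_sorted le_jj'.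
- by rewrite /ps sigma_rho; apply: tableE.
- rewrite /wr; have -> : (n.-1 - (n.-1 - rho j))%N = rho j.
    by have := ltn_ord (rho j); lia.
  by rewrite sigma_rho; apply: tableE.
- exact: tableE.
- by [].
set S := consecutive_schedule _ _ _ _ in gs.
exists S => [R|].
  apply: greedy_optimal_synchronized (greedy_schedule_map R gs).
  - exact: valid_map.
  - exact: antithetical_map.
have in_fits i : (i < size (encode_instance I))%N ->
    fits K (nth 0 (encode_instance I) i).
  by move=> lt_i; apply: fits_le (ratbits_fits _); apply/leq_input_size/mem_nth.
have sizeE := size_encode_instance I.
have p_fits j : (j < n)%N -> fits K (p j).
  by move=> lt_j; rewrite /p -nth_ptime //; apply: in_fits; lia.
have w_fits j : (j < n)%N -> fits K (w j).
  by move=> lt_j; rewrite /w -nth_weight //; apply: in_fits; lia.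
have c_fits l : (l < m)%N -> fits K (c l).
  by move=> lt_l; rewrite /c -nth_cost //; apply: in_fits; lia.
have sizeK : (2 + n + n + m <= K)%N by rewrite -sizeE size_input_size.
have := run_schedule sigma_lt sigmaK p_fits w_fits c_fits
  (mem := nth 0 (encode_instance I)) erefl erefl.
case.
- by split; [apply: nth_ptime | apply: nth_weight | apply: nth_cost].
(* Registers, and memory beyond the input, hold 0, of bit length 3; this is where the summand 3 of
   [W] is used. *)
- split=> i; first by rewrite addn3.
  have [lt_i|ge_i] := ltnP i (size (encode_instance I)); last first.
    by rewrite /= nth_default // addn3.
  apply: leq_trans (leq_input_size (mem_nth 0 lt_i)) _; rewrite -/K; nia.
move=> s [T [e T_le _ outE]]; exists s, T; split=> //.
- rewrite outE -map_enum_ord /encode_schedule; congr flatten.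
  apply: eq_map => j; rewrite /output_job /S /= rhoE; congr (_ :: flatten _).
  rewrite -map_enum_ord; apply: eq_map => l; rewrite /output_piece -?rhoE.
  by case: ifP.
have -> : (('X + 100%:P) ^+ 7).[K] = ((K + 100) ^ 7)%N.
  by rewrite horner_exp hornerD hornerX hornerC natrXE; congr expn.
apply: leq_trans T_le _.
have nX : (n + 2 <= K.+1)%N by lia.
have AX : (m * K + 3 * m + K + 6 <= 6 * K.+1 ^ 2)%N by rewrite -mulnn; nia.
have WX := leq_mul nX AX.
have mX : ((n + m + 1) ^ 2 <= (K + 100) ^ 2)%N by rewrite leq_exp2r //; lia.
rewrite (_ : (K + 100) ^ 7 = (K + 100) * (K + 100) ^ 2 * (K + 100) ^ 4)%N; last first.
  by rewrite -{2}(expn1 (K + 100)) -!expnD.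
apply: leq_mul; first by apply: leq_mul mX; lia.
apply: (@leq_trans (45 * K.+1 ^ 3)).
  have X_gt0 : (0 < K.+1 ^ 3)%N by rewrite expn_gt0.
  by move: WX; rewrite (expnS K.+1 2) -mul2n; nia.
by rewrite (expnS _ 3) leq_mul ?leq_exp2r //; lia.
Qed.

Theorem theorem4 :
  (forall (R : realFieldType) (I : instance R), valid I -> antithetical I ->
     exists S : schedule_for I, optimal_synchronized S)
  /\
  polytime_computable encode_instance
    (fun (I : instance rat) (S : schedule_for I) => encode_schedule S)
    (fun I : instance rat => valid I /\ antithetical I)
    (fun (I : instance rat) (S : schedule_for I) =>
       forall R : realFieldType,
         optimal_synchronized (I := map_instance (ratr : rat -> R) I)
           (map_schedule (ratr : rat -> R) S)).
Proof. by split; [apply: optimal_synchronized_exists | apply: schedule_polytime]. Qed.
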